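(* Let $M\in\mathbb{N}$, $\mathcal{I}=\{1,\dots,M\}$, and let $f_1,\dots,f_M:\mathbb{R}^n\to\mathbb{R}^n$ be locally Lipschitz vector fields with $f_i(0)=0$ such that each $\dot x=f_i(x)$ has unique solutions defined for all $t\in\mathbb{R}$, with flow $\Phi_i:\mathbb{R}\times\mathbb{R}^n\to\mathbb{R}^n$. Let $\tau_2\ge\tau_1\ge 0$. The switched system $\dot x(t)=f_{\sigma(t)}(x(t))$ is GUAS on $\mathcal{S}_{\mathrm{dw}}(\tau_1,\tau_2)$ (and thus on $\mathcal{S}^\star_{\mathrm{dw}}(\tau_1,\tau_2)$) if and only if there exist $\alpha_1,\alpha_2\in\mathcal{K}_\infty$ and continuous functions $V_i^-,V_i^+:\mathbb{R}^n\to\mathbb{R}$, for $i\in\mathcal{I}$, such that $$\alpha_1(|x|)\le V_i^{*}(x)\le\alpha_2(|x|)\quad\forall i\in\mathcal{I},\ \forall *\in\{-,+\},\ \forall x\in\mathbb{R}^n,$$ $$V_i^+(\Phi_i(t,x))\le e^{-t}V_i^-(x)\quad\forall i\in\mathcal{I},\ \forall t\in[0,\tau_2-\tau_1],\ \forall x\in\mathbb{R}^n,$$ $$V_j^-(\Phi_i(\tau_1,x))\le e^{-\tau_1}V_i^+(x)\quad\forall i,j\in\mathcal{I}\text{ with }i\ne j,\ \forall x\in\mathbb{R}^n.$$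
   Context: $\mathbb{R}_+=[0,\infty)$. A function $\alpha:\mathbb{R}_+\to\mathbb{R}$ is of class $\mathcal{K}$ if it is continuous, strictly increasing and $\alpha(0)=0$; it is of class $\mathcal{K}_\infty$ if in addition it is unbounded. A continuous $\beta:\mathbb{R}_+\times\mathbb{R}_+\to\mathbb{R}_+$ is of class $\mathcal{KL}$ if $\beta(\cdot,s)\in\mathcal{K}$ for every $s$, and for every $r$ the function $\beta(r,\cdot)$ is decreasing with $\beta(r,s)\to 0$ as $s\to\infty$. $\Phi_i(t,x)$ is the value at time $t$ of the solution of $\dot x=f_i(x)$ starting at $x$ at time $0$. $\mathcal{S}$ is the set of piecewise constant, right-continuous signals $\sigma:\mathbb{R}_+\to\mathcal{I}$. For $\sigma\in\mathcal{S}$, set $t_0^\sigma=0$ and let $t_1^\sigma<t_2^\sigma<\cdots$ be the positive times at which $\sigma$ is discontinuous (switching instants); if there are infinitely many, they are unbounded. For $x\in\mathbb{R}^n$, $\Phi_\sigma(t,x)$ denotes the solution at time $t\ge0$ of $\dot x(t)=f_{\sigma(t)}(x(t))$ with initial condition $x$ at time $0$. For $\tau_2\ge\tau_1\ge0$: $\mathcal{S}_{\mathrm{dw}}(\tau_1,\tau_2)$ is the set of $\sigma\in\mathcal{S}$ having infinitely many switching instants and satisfying $\tau_1\le t_k^\sigma-t_{k-1}^\sigma\le\tau_2$ for all $k\ge1$. $\mathcal{S}^\star_{\mathrm{dw}}(\tau_1,\tau_2)$ is the set of $\sigma\in\mathcal{S}$ having infinitely many switching instants and satisfying $t_1^\sigma\le\tau_2$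 and $\tau_1\le t_{k+1}^\sigma-t_k^\sigma\le\tau_2$ for all $k\ge1$. For $\widetilde{\mathcal{S}}\subseteq\mathcal{S}$, the switched system is globally uniformly asymptotically stable (GUAS) on $\widetilde{\mathcal{S}}$ if there is $\beta\in\mathcal{KL}$ such that $|\Phi_\sigma(t,x)|\le\beta(|x|,t)$ for all $\sigma\in\widetilde{\mathcal{S}}$, $x\in\mathbb{R}^n$, $t\in\mathbb{R}_+$. *)

(* Defs.v *)
From HB Require Import structures.
From mathcomp Require Import all_boot all_order all_algebra.
From mathcomp Require Import all_classical all_reals all_analysis.

Set Implicit Arguments.
Unset Strict Implicit.
Unset Printing Implicit Defensive.

Import Order.TTheory GRing.Theory Num.Theory.
Import numFieldNormedType.Exports.

Local Open Scope classical_set_scope.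
Local Open Scope ring_scope.

(** The norm of the library on ['rV[R]_n] is the sup norm; it is used below only
    through the topology it induces and the (norm independent) notion of
    Lipschitz map. *)
Definition enorm (R : realType) (n : nat) (x : 'rV[R]_n) : R :=
  Num.sqrt (\sum_(i < n) x ord0 i ^+ 2).

(** Functions on [0, +oo) are total functions on [R]; their values at negative
    arguments are never constrained. *)

Definition class_K (R : realType) (a : R -> R) : Prop :=
  [/\ {within `[0, +oo[, continuous a},
      {in `[0, +oo[ &, {homo a : r s / r < s}}
    & a 0 = 0].

Definition class_Kinfty (R : realType) (a : R -> R) : Prop :=
  class_K a /\ forall B : R, exists2 r : R, 0 <= r & B < a r.

(** [b r] is decreasing in the weak sense: [b 0] is identically [0]. *)
Definition class_KL (R : realType) (b : R -> R -> R) : Prop :=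
  [/\ {within `[0, +oo[ `*` `[0, +oo[, continuous (fun p : R * R => b p.1 p.2)},
      forall s : R, 0 <= s -> class_K (b ^~ s),
      forall r : R, 0 <= r -> {in `[0, +oo[ &, {homo b r : s t / s <= t >-> t <= s}}
    & forall r : R, 0 <= r -> b r s @[s --> +oo] --> 0].

Definition locally_lipschitz (R : realType) (n : nat)
    (f : 'rV[R]_n -> 'rV[R]_n) : Prop :=
  forall x : 'rV[R]_n, exists2 U : set 'rV[R]_n, nbhs x U & [lipschitz f z | z in U].

Definition global_solution (R : realType) (n : nat)
    (f : 'rV[R]_n -> 'rV[R]_n) (y : R -> 'rV[R]_n) : Prop :=
  forall t : R, is_derive t 1 y (f (y t)).

Definition is_flow (R : realType) (n : nat)
    (f : 'rV[R]_n -> 'rV[R]_n) (phi : R -> 'rV[R]_n -> 'rV[R]_n) : Prop :=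
  forall x, [/\ phi 0 x = x,
                global_solution f (phi ^~ x)
              & forall y, global_solution f y -> y 0 = x ->
                  forall t, y t = phi t x].

(** A signal is a function on [R] of which only the restriction to [0, +oo)
    matters. Continuity refers to the discrete topology on the index set, i.e.
    it means being locally constant. *)

Definition switching_instants (R : realType) (M : nat) (s : R -> 'I_M) : set R :=
  [set t : R | 0 < t /\ ~ (\forall u \near t, s u = s t)].

(** A function with values in a discrete set is constant on every interval free
    of discontinuities, so piecewise constancy amounts to having finitely many
    discontinuities in every bounded interval. *)
Definition signals (R : realType) (M : nat) : set (R -> 'I_M) :=
  [set s | (forall T : R, finite_set (switching_instants s `&` [set t : R | t <= T]))
        /\ (forall t : R, 0 <= t -> \forall u \near t^'+, s u = s t)].

(** The existence of such a [t] entails that there are infinitely many switching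
    instants; conversely, since they are locally finite, [t] then exists and is
    unique. *)
Definition enumerates_instants (R : realType) (M : nat) (s : R -> 'I_M)
    (t : nat -> R) : Prop :=
  [/\ t 0%N = 0,
      {homo t : k l / (k < l)%N >-> k < l}
    & switching_instants s = range (fun k => t k.+1)].

Definition S_dw (R : realType) (M : nat) (tau1 tau2 : R) : set (R -> 'I_M) :=
  [set s | signals s /\ exists2 t : nat -> R, enumerates_instants s t &
     forall k, tau1 <= t k.+1 - t k <= tau2].

Definition S_dw_star (R : realType) (M : nat) (tau1 tau2 : R) :
    set (R -> 'I_M) :=
  [set s | signals s /\ exists2 t : nat -> R, enumerates_instants s t &
     t 1%N <= tau2 /\ forall k, tau1 <= t k.+2 - t k.+1 <= tau2].

Definition switched_solution (R : realType) (n M : nat)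
    (f : 'I_M -> 'rV[R]_n -> 'rV[R]_n) (s : R -> 'I_M) (x : 'rV[R]_n) :
    set (R -> 'rV[R]_n) :=
  [set y : R -> 'rV[R]_n | [/\ y 0 = x,
               {within `[0, +oo[, continuous y}
             & forall t : R, 0 < t -> ~ switching_instants s t ->
                 is_derive t 1 y (f (s t) (y t))]].

(** When the [f i] are locally Lipschitz and complete and [s] is a signal, a
    solution exists and its values at nonnegative times are unique, so the
    default value [cst 0] is not used. *)
Definition switched_flow (R : realType) (n M : nat)
    (f : 'I_M -> 'rV[R]_n -> 'rV[R]_n) (s : R -> 'I_M) (t : R)
    (x : 'rV[R]_n) : 'rV[R]_n :=
  xget (cst 0) (switched_solution f s x) t.

Definition GUAS (R : realType) (n M : nat)
    (f : 'I_M -> 'rV[R]_n -> 'rV[R]_n) (S : set (R -> 'I_M)) : Prop :=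
  exists2 b : R -> R -> R, class_KL b &
    forall s x t, S s -> 0 <= t ->
      enorm (switched_flow f s t x) <= b (enorm x) t.

(* Main.v *)
Require Import Defs.
From HB Require Import structures.
From mathcomp Require Import all_boot all_order all_algebra.
From mathcomp Require Import all_classical all_reals all_analysis.
From mathcomp Require Import ring lra.

Set Implicit Arguments.
Unset Strict Implicit.
Unset Printing Implicit Defensive.

Import Order.TTheory GRing.Theory Num.Theory.
Import numFieldNormedType.Exports.

Local Open Scope classical_set_scope.
Local Open Scope ring_scope.

(** A signal with its switching instants amounts to a schedule: a sequence of
    modes, consecutive ones being distinct, and a sequence of dwells. Along it
    the state is a composition of the flows ([switched_flow_visit]), and
    conversely every schedule whose dwells are bounded away from 0 comes from a
    signal ([schedule_signal]). The two implications are proved on schedules.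

    Lyapunov functions give stability. A dwell [t] between [tau1] and [tau2] in
    mode [i] is a time [t - tau1] during which [V_i^-] is turned into [V_i^+],
    followed by a time [tau1] after which [V_i^+] is turned into [V_j^-], so the
    dwell multiplies the Lyapunov function of the current mode by at most
    [exp (- t)]
    ([lyapunov_dwell_decay]). What this leaves out, a first dwell that is
    possibly shorter than [tau1] and the dwell under way at the final time,
    lasts at most [2 * tau2] in all; there the flows are estimated by a
    comparison function [w] with [w |Phi_i t x| <= |x|] ([flow_minorant]). This
    covers the larger class with a free first dwell at once, which is why
    stability on one class of signals implies stability on the other
    ([lyapunov_GUAS_star], [S_dw_sub_star]).

    Stability gives Lyapunov functions. Every class KL function [b] satisfies
    [w (b r t) <= exp (- 2 t) * h r] for some [w] and [h] of class K-infinity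
    ([KL_exp_bound]). Then [V_i^-(x)] is the supremum of
    [exp t * w |state at time t|] over the times [t] and the schedules that
    start from [x] in mode [i], and [V_i^+(x)] is the same supremum restricted
    to first dwells equal to [tau1]. The supremum lies between [w |x|] and
    [h |x|]. A schedule that enters [V_i^+(Phi_i t x)], once it is preceded by
    the time [t] in mode [i], enters [V_i^-(x)] with its weights multiplied by
    [exp t], and similarly for the other decay condition
    ([lyapunov_switching]). The weights [exp t] only use up half of the decay
    [exp (- 2 t)], so long times contribute little, uniformly on bounded sets;
    over bounded times Gronwall's inequality makes the states equi-Lipschitz in
    [x], and the supremum is continuous ([sup_value_continuous]). Schedules may
    have zero dwells when [tau1 = 0]; the stability estimate reaches them by
    perturbing the dwells ([schedule_bound]). Two degenerate cases in which no
    signal belongs to the class, at most one mode and [tau2 = 0], are treated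
    apart. *)

(** * Comparison functions *)

Section ClassK.
Variable R : realType.
Implicit Types (a : R -> R) (r s t : R).

Lemma cvg_two_sided (T : Type) (F : set_system T) (FF : Filter F) (f : T -> R)
    (l : R) :
  (forall e : R, 0 < e -> \forall x \near F, f x < l + e /\ l - e < f x) ->
  f @ F --> l.
Proof.
move=> h; apply/cvgrPdist_lt => e /h; apply: filterS => x [h1 h2].
by rewrite ltr_distlC h1 h2.
Qed.

Lemma class_K_lt a r s : class_K a -> 0 <= r -> r < s -> a r < a s.
Proof.
move=> [_ inc _] r0 rs; apply: inc => //; rewrite in_itv/= andbT//.
exact: le_trans (ltW rs).
Qed.

Lemma class_K_le a r s : class_K a -> 0 <= r -> r <= s -> a r <= a s.
Proof.
move=> aK r0; rewrite le_eqVlt => /predU1P[->//|rs].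
exact/ltW/class_K_lt.
Qed.

Lemma class_K_ge0 a r : class_K a -> 0 <= r -> 0 <= a r.
Proof. by move=> aK r0; rewrite -(let: And3 _ _ e := aK in e) class_K_le. Qed.

Lemma class_K_le_inv a r s : class_K a -> 0 <= s -> a r <= a s -> r <= s.
Proof.
by move=> aK s0; apply: contraTT; rewrite -!ltNge; exact: class_K_lt.
Qed.

Lemma max0_continuous : continuous (fun r : R => Num.max r 0).
Proof. by move=> x; apply: continuous_max; [exact: cvg_id|exact: cvg_cst]. Qed.

(** Clamping the argument at 0 turns continuity relative to the half line into
    continuity on the whole line, where composition lemmas apply directly. *)
Lemma class_K_extend a : class_K a -> continuous (fun r => a (Num.max r 0)).
Proof.
move=> [/continuous_within_itvcyP[a_in a_at0] _ _] r.
have [r0|r0|->] := ltgtP r 0.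
- apply: (@cvg_near_cst _ _ _ _ _ _).
  have : \forall u \near r, u < 0 by exact: lt_nbhsl.
  by apply: filterS => u u0; rewrite !max_r// ltW.
- apply: (@continuous_comp _ _ _ (fun r : R => Num.max r 0) a).
    exact: max0_continuous.
  by apply: a_in; rewrite max_l ?ltW// in_itv/= andbT.
- apply/left_right_continuousP; split.
    apply: (@cvg_near_cst _ _ _ _ _ _).
    by near=> u; rewrite maxxx max_r// ltW//; near: u; exact: nbhs_left_lt.
  rewrite maxxx; apply: cvg_trans a_at0; apply: near_eq_cvg.
  by near=> u; rewrite max_l// ltW//; near: u; exact: nbhs_right_gt.
Unshelve. all: by end_near.
Qed.

Lemma class_K_small a e : class_K a -> 0 < e -> exists2 d, 0 < d & a d < e.
Proof.
move=> aK e0; have /cvgrPdist_lt /(_ e e0) := @class_K_extend _ aK 0.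
have a0 : a 0 = 0 by case: aK.
rewrite maxxx a0 => /nbhs_ballP[d/= d0 dP].
exists (d / 2); first by rewrite divr_gt0.
have := dP (d / 2); rewrite max_l ?divr_ge0 ?ltW// sub0r normrN => dP2.
apply: le_lt_trans (ler_norm _) _; apply: dP2.
by rewrite /ball/= sub0r normrN gtr0_norm ?divr_gt0// ltr_pdivrMr// ltr_pMr// ltr1n.
Qed.

Lemma continuous_within_eq (T S : topologicalType) (A : set T) (f g : T -> S) :
  continuous g -> (forall x, A x -> g x = f x) -> {within A, continuous f}.
Proof.
move=> gc gf; apply: (@subspace_eq_continuous _ A _ g); last first.
  exact: continuous_subspaceT.
by move=> x /set_mem; exact: gf.
Qed.

Lemma class_K_intro a g : continuous g -> (forall r, 0 <= r -> g r = a r) ->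
  (forall r s, 0 <= r -> r < s -> a r < a s) -> a 0 = 0 -> class_K a.
Proof.
move=> gc ga a_lt a0; split => //.
  apply: (@continuous_within_eq _ _ _ _ g) => // r.
  by rewrite /= in_itv/= andbT; exact: ga.
by move=> r s /itvP r0 _; apply: a_lt; rewrite r0.
Qed.

Lemma class_K_comp a b : class_K a -> class_K b -> class_K (a \o b).
Proof.
move=> aK bK; have cvb := class_K_extend bK; have cva := class_K_extend aK.
have [_ _ a0] := aK; have [_ _ b0] := bK.
apply: (@class_K_intro _ (fun r => a (Num.max (b (Num.max r 0)) 0))).
- move=> r; apply: (@continuous_comp _ _ _ (fun r => b (Num.max r 0))
    (fun r => a (Num.max r 0))); [exact: cvb|exact: cva].
- by move=> r r0; rewrite [in X in b X]max_l// max_l// class_K_ge0.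
- move=> r s r0 rs /=; apply: class_K_lt => //; first exact: class_K_ge0.
  exact: class_K_lt.
- by rewrite /= b0.
Qed.

Lemma class_Kinfty_comp a b :
  class_Kinfty a -> class_Kinfty b -> class_Kinfty (a \o b).
Proof.
move=> [aK au] [bK bu]; split; first exact: class_K_comp.
move=> B; have [s s0 Bs] := au B; have [r r0 sr] := bu s.
by exists r => //=; apply: lt_trans Bs _; exact: class_K_lt.
Qed.

Lemma class_Kinfty_scale (c : R) : 0 < c -> class_Kinfty (fun r : R => c * r).
Proof.
move=> c0; split.
  apply: (@class_K_intro _ (fun r => c * r)) => //; last by rewrite mulr0.
    by move=> r; apply: cvgM; [exact: cvg_cst|exact: cvg_id].
  by move=> r s _ rs; rewrite ltr_pM2l.
move=> B; exists (Num.max 0 (B / c) + 1).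
  by rewrite addr_ge0// le_max lexx.
rewrite mulrC -ltr_pdivrMr//; apply: (@le_lt_trans _ _ (Num.max 0 (B / c))).
  by rewrite le_max lexx orbT.
by rewrite ltrDl.
Qed.

(** The inverse function, specified by its Galois connection with [a]; the
    other properties, continuity included, all follow from that connection. *)
Lemma class_Kinfty_inv a : class_Kinfty a ->
  exists2 c : R -> R, class_Kinfty c & forall r s, 0 <= r -> 0 <= s ->
    (r <= c s) = (a r <= s).
Proof.
move=> [aK au]; have a0 : a 0 = 0 by case: aK.
have surj s : exists r, 0 <= s -> 0 <= r /\ a r = s.
  have [s0|] := leP 0 s; last by exists 0.
  have [B B0 sB] := au s.
  have aB : a 0 <= a B by rewrite class_K_le.
  have := @IVT R (fun r => a (Num.max r 0)) 0 B s B0.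
  case.
  - apply: continuous_subspaceT; exact: class_K_extend.
  - rewrite maxxx (max_l B0) (min_l aB) (max_r aB) a0 s0/=; exact: ltW.
  move=> r /itvP r0 <-; exists r => _; rewrite max_l ?r0//.
have [c cP] := choice surj.
have gal r s : 0 <= r -> 0 <= s -> (r <= c s) = (a r <= s).
  move=> r0 s0; have [cs0 ecs] := cP _ s0.
  apply/idP/idP; first by move=> rc; rewrite -ecs class_K_le.
  by rewrite -{1}ecs; exact: class_K_le_inv.
have c_lt r s : 0 <= r -> r < s -> c r < c s.
  move=> r0 rs; have s0 := le_trans r0 (ltW rs).
  rewrite ltNge gal ?(cP _ s0).1// -ltNge.
  by have [_ ->] := cP _ s0.
have c0 : c 0 = 0.
  apply/eqP; rewrite eq_le (cP 0 _).1// andbT leNgt; apply/negP => c0.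
  by have := class_K_lt aK (lexx 0) c0; rewrite (cP 0 _).2// a0 ltxx.
exists c => //; split; last first.
  move=> B; pose B' := Num.max B 0.
  have B'0 : 0 <= B' by rewrite le_max lexx orbT.
  have B1 : 0 <= B' + 1 by rewrite addr_ge0.
  have aB1 := class_K_ge0 aK B1.
  exists (a (B' + 1)) => //; apply: (@lt_le_trans _ _ (B' + 1)).
    by rewrite ltr_pwDr// le_max lexx.
  by rewrite gal.
split=> //; last first.
  by move=> r s /itvP r0 _ rs; rewrite c_lt// r0.
apply/subspace_continuousP => s; rewrite /= in_itv/= andbT => s0.
have [cs0 ecs] := cP _ s0.
rewrite /from_subspace; apply: cvg_two_sided => e e0; rewrite near_withinE.
have [h|h] := ltP (c s - e / 2) 0; near=> u.
- rewrite /= in_itv/= andbT => u0; have [cu0 _] := cP _ u0.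
  split; last by lra.
  rewrite ltNge gal ?addr_ge0 ?(ltW e0)// -ltNge.
  near: u; apply: lt_nbhsl.
  by rewrite -{1}ecs class_K_lt// ltrDl.
- rewrite /= in_itv/= andbT => u0; have [cu0 _] := cP _ u0.
  split; last first.
    suff : c s - e / 2 <= c u by lra.
    rewrite gal//; near: u; apply: lt_le_nbhsr.
    by rewrite -[ltRHS]ecs class_K_lt// ltrBlDr ltrDl divr_gt0.
  rewrite ltNge gal ?addr_ge0 ?(ltW e0)// -ltNge.
  near: u; apply: lt_nbhsl.
  by rewrite -{1}ecs class_K_lt// ltrDl.
Unshelve. all: by end_near.
Qed.

End ClassK.

Section RampEnvelope.
Variables (R : realType) (Q : set (R * R)).
Hypotheses (Qn0 : Q !=set0) (Q_ge0 : forall q, Q q -> 0 <= q.2).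

(** The best lower estimate of [v] at [u], over the pairs [(u, v)] of [Q], by a
    nondecreasing 1-Lipschitz function: each pair contributes the ramp that has
    value [v] up to [u] and then grows with slope 1. *)
Definition ramp_envelope (s : R) : R :=
  inf [set q.2 + Num.max 0 (s - q.1) | q in Q].

Let lbound0 s : lbound [set q.2 + Num.max 0 (s - q.1) | q in Q] 0.
Proof. by move=> _ [q /Q_ge0 q0 <-]; rewrite addr_ge0// le_max lexx. Qed.

Let im_n0 s : [set q.2 + Num.max 0 (s - q.1) | q in Q] !=set0.
Proof. by have [q Qq] := Qn0; eexists; exists q. Qed.

Lemma ramp_envelope_ge0 s : 0 <= ramp_envelope s.
Proof. exact: lb_le_inf. Qed.

Lemma ramp_envelope_le q s : Q q ->
  ramp_envelope s <= q.2 + Num.max 0 (s - q.1).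
Proof. by move=> Qq; apply: ge_inf; [exists 0|exists q]. Qed.

Lemma ramp_envelope_homo : {homo ramp_envelope : s t / s <= t}.
Proof.
move=> s t st; apply: lb_le_inf => // _ [q Qq <-].
apply: le_trans (ramp_envelope_le s Qq) _.
by rewrite lerD2l le_max2// lerB.
Qed.

Lemma ramp_envelope_lip s t : s <= t ->
  ramp_envelope t <= ramp_envelope s + (t - s).
Proof.
move=> st; rewrite -lerBlDr; apply: lb_le_inf => // _ [q Qq <-].
rewrite lerBlDr; apply: le_trans (ramp_envelope_le t Qq) _.
by rewrite -addrA lerD2l; case: (leP 0 (t - q.1)); case: (leP 0 (s - q.1)); lra.
Qed.

(** At [s], a ramp that starts before [s - c] has already risen by [c]; only the
    pairs to the right of [s - c] can make the envelope small. *)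
Lemma ramp_envelope_lower (c d s : R) :
  (forall q, Q q -> s - c <= q.1 -> d <= q.2) ->
  Num.min c d <= ramp_envelope s.
Proof.
move=> h; apply: lb_le_inf => // _ [q Qq <-].
have [sq|qs] := leP (s - c) q.1.
  rewrite ge_min; apply/orP; right; apply: le_trans (h _ Qq sq) _.
  by rewrite lerDl le_max lexx.
rewrite ge_min; apply/orP; left.
apply: (@le_trans _ _ (Num.max 0 (s - q.1))).
  by rewrite le_max; apply/orP; right; lra.
by rewrite lerDr Q_ge0.
Qed.

Lemma ramp_envelope_continuous : continuous ramp_envelope.
Proof.
move=> s; apply: cvg_two_sided => e e0; near=> t.
have ste : s - e < t /\ t < s + e.
  split; near: t; [apply: lt_nbhsr; rewrite ltrBlDr ltrDl//|].
  by apply: lt_nbhsl; rewrite ltrDl.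
have [st|/ltW ts] := leP s t.
  by have := ramp_envelope_lip st; have := ramp_envelope_homo st; lra.
by have := ramp_envelope_lip ts; have := ramp_envelope_homo ts; lra.
Unshelve. all: by end_near.
Qed.

End RampEnvelope.

Section Minorant.
Variable R : realType.

Lemma frac_lt (s t : R) : 0 <= s -> s < t -> s / (1 + s) < t / (1 + t).
Proof.
move=> s0 st; rewrite ltr_pdivrMr; last lra.
rewrite mulrAC ltr_pdivlMr; last lra.
nra.
Qed.

(** A family of constraints [w s <= v] can be met by a class K-infinity function
    as soon as small values [v] only constrain small arguments, and bounded
    values only bounded arguments. The ramp envelope is continuous and
    nondecreasing, and multiplying it by [s / (1 + s)] makes it strictly
    increasing. *)
Lemma Kinfty_minorant (P : set (R * R)) :
  (forall p, P p -> 0 <= p.2) ->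
  (forall s, 0 < s -> exists2 c, 0 < c & forall p, P p -> p.2 < c -> p.1 < s) ->
  (forall B, exists s, forall p, P p -> p.2 < B -> p.1 < s) ->
  exists w : R -> R, [/\ class_Kinfty w,
    forall s t, 0 <= s -> s <= t -> w t <= w s + 2 * (t - s)
    & forall p, P p -> 0 <= p.1 -> w p.1 <= p.2].
Proof.
move=> P_ge0 small bdd; pose Q := (0, 0) |` P.
(* The added pair gives [e s <= s], whence the Lipschitz bound on the product. *)
have Qn0 : Q !=set0 by exists (0, 0); left.
have Q_ge0 q : Q q -> 0 <= q.2 by move=> [->//|/P_ge0].
pose e := ramp_envelope Q.
have e_ge0 s : 0 <= e s := ramp_envelope_ge0 Qn0 Q_ge0 s.
have e_homo : {homo e : s t / s <= t} by exact: ramp_envelope_homo.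
have e_le s : 0 <= s -> e s <= s.
  move=> s0; have /= := @ramp_envelope_le _ Q Q_ge0 (0, 0) s (or_introl erefl).
  by rewrite subr0 add0r max_r.
have e_lip s t : s <= t -> e t <= e s + (t - s) by exact: ramp_envelope_lip.
have e_gt0 s : 0 < s -> 0 < e s.
  move=> s0; have s2 : 0 < s / 2 by rewrite divr_gt0.
  have [c c0 cP] := small _ s2.
  apply: (@lt_le_trans _ _ (Num.min (s / 2) c)); first by rewrite lt_min s2.
  apply: ramp_envelope_lower => // q Qq sq; rewrite leNgt; apply/negP => qc.
  case: Qq qc sq => [->/=|Pq qc]; first lra.
  by have := cP _ Pq qc; lra.
pose w s := e s * (s / (1 + s)).
have w_lt s t : 0 <= s -> s < t -> w s < w t.
  move=> s0 st; apply: (@le_lt_trans _ _ (e t * (s / (1 + s)))).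
    by apply: ler_wpM2r; [rewrite divr_ge0//; lra|exact/e_homo/ltW].
  by rewrite ltr_pM2l ?frac_lt// e_gt0//; lra.
exists w; split.
- split.
    apply: (@class_K_intro _ _
      (fun s => e s * (Num.max s 0 / (1 + Num.max s 0)))) => //.
    + move=> s; apply: cvgM; first exact: ramp_envelope_continuous.
      apply: cvgM; first exact: max0_continuous.
      apply: cvgV; last by apply: cvgD; [exact: cvg_cst|exact: max0_continuous].
      have : 0 <= Num.max s 0 by rewrite le_max lexx orbT.
      by move=> ?; rewrite gt_eqF//; lra.
    + by move=> r r0; rewrite max_l.
    + by rewrite /w mul0r mulr0.
  move=> B; pose B' := Num.max B 0 + 1.
  have B'B : B < B' by rewrite ltr_pwDr// le_max lexx.
  have B'1 : 1 <= B' by rewrite lerDr le_max lexx orbT.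
  have [s0 s0P] := bdd (2 * B').
  pose s := Num.max (2 * B' + 1) (s0 + 2 * B').
  have s1 : 2 * B' + 1 <= s by rewrite le_max lexx.
  exists s; first lra.
  have se : 2 * B' <= e s.
    rewrite -[X in X <= _]minxx.
    apply: ramp_envelope_lower => // q Qq sq; rewrite leNgt; apply/negP => qc.
    case: Qq qc sq => [->/=|Pq qc]; first lra.
    have := s0P _ Pq qc; have : s0 + 2 * B' <= s by rewrite le_max lexx orbT.
    lra.
  apply: lt_le_trans B'B _.
  have : 1 / 2 <= s / (1 + s) by rewrite ler_pdivlMr; lra.
  by rewrite /w; nra.
- move=> s t s0 st; have t0 := le_trans s0 st.
  have et : e t * (t / (1 + t)) <= (e s + (t - s)) * (t / (1 + t)).
    by apply: ler_wpM2r; [rewrite divr_ge0//; lra|exact: e_lip].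
  apply: le_trans et _.
  have t1 : t / (1 + t) <= 1 by rewrite ler_pdivrMr; lra.
  have es : e s * (t / (1 + t) - s / (1 + s)) <= t - s.
    have -> : t / (1 + t) - s / (1 + s) = (t - s) / ((1 + t) * (1 + s)).
      by field; rewrite !gt_eqF//; lra.
    rewrite mulrA ler_pdivrMr; last by apply: mulr_gt0; lra.
    rewrite mulrC ler_wpM2l ?subr_ge0//; have := e_le _ s0; nra.
  rewrite /w; nra.
- move=> [s v] Pp /= s0; apply: (@le_trans _ _ (e s)).
    by rewrite -[leRHS]mulr1 ler_wpM2l// ler_pdivrMr; lra.
  have /= := @ramp_envelope_le _ Q Q_ge0 (s, v) s (or_intror Pp).
  by rewrite subrr maxxx addr0.
Qed.

End Minorant.

Section KL.
Variable R : realType.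

Lemma class_KL_tail (b : R -> R -> R) r e : class_KL b -> 0 <= r -> 0 < e ->
  exists2 T, 0 <= T & forall t, T <= t -> b r t < e.
Proof.
move=> [_ _ _ lim0] r0 e0; have /cvgrPdist_lt/(_ e e0)[T [_ TP]] := lim0 r r0.
exists (Num.max T 0 + 1); first by rewrite addr_ge0// le_max lexx orbT.
move=> t Tt; have /TP : T < t.
  by apply: lt_le_trans Tt; rewrite ltr_pwDr// le_max lexx.
by rewrite sub0r normrN; apply: le_lt_trans (ler_norm _).
Qed.

(** Sontag's lemma on class KL functions. It suffices that [exp (- 2 t) * h r]
    be bounded below in terms of [b r t], and [Kinfty_minorant] then yields [w].
    The function [h] is chosen to grow so fast that [exp (- 2 t) * h r >= r] as
    long as [b r t >= 1 / (1 + r)]. If [b r t >= s], then either [r >= 1 / s]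
    and that estimate applies, or [r < 1 / s] and [t] is bounded. *)
Lemma KL_exp_bound (b : R -> R -> R) : class_KL b ->
  exists w h : R -> R, [/\ class_Kinfty w, class_Kinfty h,
    forall s t, 0 <= s -> s <= t -> w t <= w s + 2 * (t - s)
    & forall r t, 0 <= r -> 0 <= t -> w (b r t) <= expR (- (2 * t)) * h r].
Proof.
move=> bKL; have [_ bK bdecr _] := bKL.
have b_decr r s t : 0 <= r -> 0 <= s -> s <= t -> b r t <= b r s.
  move=> r0 s0 st; apply: bdecr => //; rewrite in_itv/= andbT//.
  exact: le_trans st.
have b_incr r s t : 0 <= r -> r <= s -> 0 <= t -> b r t <= b s t.
  by move=> r0 rs t0; exact: (class_K_le (bK _ t0)).
have b_ge0 r t : 0 <= r -> 0 <= t -> 0 <= b r t.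
  by move=> r0 t0; exact: (class_K_ge0 (bK _ t0)).
(* [g] has to be nonincreasing, hence the change of sign of the first component;
   the pairs with second component 0 only serve to have [g <= 1]. *)
pose Q := [set (- p.1, expR (- (2 * p.2))) | p in
  [set p : R * R | [/\ 0 <= p.1, 0 <= p.2 &
                      p.2 = 0 \/ (1 + p.1)^-1 <= b p.1 p.2]]].
have Qn0 : Q !=set0.
  by exists (- 0, expR (- (2 * 0))), (0, 0) => //=; split => //; left.
have Q_ge0 q : Q q -> 0 <= q.2 by move=> [p _ <-]; exact: expR_ge0.
pose g r := ramp_envelope Q (- r).
have g_le r t : 0 <= r -> 0 <= t -> (1 + r)^-1 <= b r t ->
    g r <= expR (- (2 * t)).
  move=> r0 t0 rt.
  have Qq : Q (- r, expR (- (2 * t))) by exists (r, t) => //; split => //; right.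
  by have := ramp_envelope_le Q_ge0 (- r) Qq; rewrite /= subrr maxxx addr0.
have g_le1 r : 0 <= r -> g r <= 1.
  move=> r0.
  have Qq : Q (- r, expR (- (2 * 0))) by exists (r, 0) => //; split => //; left.
  have := ramp_envelope_le Q_ge0 (- r) Qq.
  by rewrite /= subrr maxxx addr0 mulr0 oppr0 expR0.
have g_gt0 r : 0 <= r -> 0 < g r.
  move=> r0; have r1 : 0 < (2 + r)^-1 by rewrite invr_gt0; lra.
  have [|T T0 TP] := class_KL_tail (r := 1 + r) bKL _ r1; first lra.
  apply: (@lt_le_trans _ _ (Num.min 1 (expR (- (2 * T))))).
    by rewrite lt_min ltr01 expR_gt0.
  apply: ramp_envelope_lower => // _ [[r' t] /= [r'0 t0 h] <-] /= rr'.
  rewrite ler_expR lerN2 ler_pM2l// leNgt; apply/negP => Tt.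
  case: h => [t_0|]; first by rewrite t_0 in Tt; lra.
  apply/negP; rewrite -ltNge.
  apply: le_lt_trans (b_incr r' (1 + r) t _ _ _) _ => //; first lra.
  apply: lt_le_trans (TP _ (ltW Tt)) _.
  by rewrite lef_pV2 ?posrE; lra.
pose h r := r / g r.
have h_ge r : 0 <= r -> r <= h r.
  move=> r0; rewrite /h ler_pdivlMr ?g_gt0//.
  by rewrite -[leRHS]mulr1 ler_wpM2l ?g_le1.
have h_lt r s : 0 <= r -> r < s -> h r < h s.
  move=> r0 rs; have s0 : 0 <= s := le_trans r0 (ltW rs).
  rewrite /h ltr_pdivrMr ?g_gt0// mulrAC ltr_pdivlMr ?g_gt0//.
  have gsr : g s <= g r by apply: ramp_envelope_homo => //; rewrite lerN2 ltW.
  apply: (@le_lt_trans _ _ (r * g r)); first by rewrite ler_wpM2l.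
  by rewrite ltr_pM2r ?g_gt0.
have hKinf : class_Kinfty h.
  split; last first.
    move=> B; exists (Num.max B 0 + 1); first by rewrite addr_ge0// le_max lexx orbT.
    apply: lt_le_trans (h_ge _ _).
      by rewrite ltr_pwDr// le_max lexx.
    by rewrite addr_ge0// le_max lexx orbT.
  apply: (@class_K_intro _ _ (fun s => Num.max s 0 / g (Num.max s 0))) => //.
  - move=> s; apply: cvgM; first exact: max0_continuous.
    apply: (@cvgV _ _ _ _ (fun s => g (Num.max s 0))).
      by rewrite gt_eqF// g_gt0// le_max lexx orbT.
    apply: (@cvg_comp _ _ _ (fun s => - Num.max s 0) (ramp_envelope Q)).
      by apply: cvgN; exact: max0_continuous.
    exact: ramp_envelope_continuous.
  - by move=> r r0; rewrite max_l.
  - by rewrite /h mul0r.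
pose P := [set (b p.1 p.2, expR (- (2 * p.2)) * h p.1) | p in
  [set p : R * R | 0 <= p.1 /\ 0 <= p.2]].
have h_ge0 r : 0 <= r -> 0 <= h r.
  by move=> r0; exact: le_trans r0 (h_ge _ r0).
have P_ge0 p : P p -> 0 <= p.2.
  by move=> [[r t] /= [r0 t0] <-] /=; rewrite mulr_ge0 ?expR_ge0 ?h_ge0.
have big r t : 0 <= r -> 0 <= t -> (1 + r)^-1 <= b r t ->
    r <= expR (- (2 * t)) * h r.
  move=> r0 t0 rt; rewrite /h mulrCA -[leLHS]mulr1 ler_wpM2l//.
  by rewrite ler_pdivlMr ?g_gt0// mul1r g_le.
have [w [wK wlip wP]] : exists w : R -> R, [/\ class_Kinfty w,
    forall s t, 0 <= s -> s <= t -> w t <= w s + 2 * (t - s)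
    & forall p, P p -> 0 <= p.1 -> w p.1 <= p.2].
  apply: Kinfty_minorant => //.
  - move=> s s0; have [rho rho0 rhos] := class_K_small (bK 0 (lexx 0)) s0.
    have [|T T0 TP] := class_KL_tail (r := s^-1) bKL _ s0.
      by rewrite invr_ge0 ltW.
    exists (Num.min rho (expR (- (2 * T)) * h rho)).
      rewrite lt_min rho0 mulr_gt0 ?expR_gt0//.
      exact: lt_le_trans rho0 (h_ge _ (ltW rho0)).
    move=> _ [[r t] /= [r0 t0] <-] /=; rewrite lt_min => /andP[v1 v2].
    rewrite ltNge; apply/negP => sb.
    have rhor : rho <= r.
      rewrite leNgt; apply/negP => rrho.
      have : b r t < s; last by rewrite ltNge sb.
      apply: le_lt_trans (b_decr _ _ _ r0 (lexx 0) t0) _.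
      by apply: le_lt_trans rhos; rewrite b_incr// ltW.
    have [sr|rs] := leP s^-1 r.
      have : r <= expR (- (2 * t)) * h r.
        apply: big => //; apply: le_trans sb.
        rewrite -[leRHS]invrK lef_pV2 ?posrE ?invr_gt0//; lra.
      by rewrite leNgt (lt_le_trans v1).
    have Tt : t < T.
      rewrite ltNge; apply/negP => /TP; apply/negP; rewrite -leNgt.
      by apply: le_trans sb _; rewrite b_incr// ltW.
    move: v2; apply/negP; rewrite -leNgt.
    apply: ler_pM; rewrite ?expR_ge0 ?h_ge0 ?(ltW rho0)//.
      by rewrite ler_expR lerN2 ler_pM2l// ltW.
    exact: class_K_le hKinf.1 (ltW rho0) rhor.
  - move=> B; pose B' := Num.max B 0.
    have B'0 : 0 <= B' by rewrite le_max lexx orbT.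
    exists (Num.max 1 (b B' 0 + 1)) => _ [[r t] /= [r0 t0] <-] /= v.
    rewrite ltNge ge_max; apply/negP => /andP[b1 b2].
    have Br : B' < r.
      rewrite ltNge; apply/negP => rB.
      have := b_decr _ _ _ r0 (lexx 0) t0; have := b_incr _ _ 0 r0 rB (lexx 0).
      lra.
    have : r <= expR (- (2 * t)) * h r.
      apply: big => //; apply: le_trans b1.
      by rewrite invf_le1; lra.
    apply/negP; rewrite -ltNge; apply: lt_trans v _.
    by apply: le_lt_trans Br; rewrite le_max lexx.
exists w, h; split => // r t r0 t0.
have Pp : P (b r t, expR (- (2 * t)) * h r) by exists (r, t).
by have /= := wP _ Pp; apply; exact: b_ge0.
Qed.

(** Exponential decay measured through [k] is a class KL estimate, obtained by
    applying the inverse of [k]. *)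
Lemma KL_of_exp_bound (k a : R -> R) (c : R) :
  class_Kinfty k -> class_Kinfty a ->
  exists2 b, class_KL b & forall r s t, 0 <= r -> 0 <= s -> 0 <= t ->
    k s <= expR (c - t) * a r -> s <= b r t.
Proof.
move=> kK aK; have [i iK iP] := class_Kinfty_inv kK.
have a_ge0 r : 0 <= r -> 0 <= a r by exact: class_K_ge0 aK.1.
have arg_ge0 r t : 0 <= r -> 0 <= expR (c - t) * a r.
  by move=> r0; rewrite mulr_ge0 ?expR_ge0 ?a_ge0.
have [_ _ i0] := iK.1; have [_ _ a0] := aK.1.
have ic := class_K_extend iK.1; have ac := class_K_extend aK.1.
exists (fun r t => i (expR (c - t) * a r)); last first.
  by move=> r s t r0 s0 t0; rewrite iP ?arg_ge0.
have expc : continuous (fun t : R => expR (c - t)).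
  move=> t; apply: (@continuous_comp _ _ _ (fun t : R => c - t) expR).
    by apply: cvgB; [exact: cvg_cst|exact: cvg_id].
  exact: continuous_expR.
split.
- apply: (@continuous_within_eq _ _ _ _ (fun p : R * R =>
      i (Num.max (expR (c - p.2) * a (Num.max p.1 0)) 0))).
    move=> p; apply: (@cvg_comp _ _ _ (fun p : R * R =>
      expR (c - p.2) * a (Num.max p.1 0)) (fun r => i (Num.max r 0)));
      last exact: ic.
    apply: cvgM.
      apply: (@cvg_comp _ _ _ (fun p : R * R => p.2) (fun t => expR (c - t)));
        last exact: expc.
      exact: cvg_snd.
    apply: (@cvg_comp _ _ _ (fun p : R * R => p.1) (fun r => a (Num.max r 0)));
      last exact: ac.
    exact: cvg_fst.
  move=> [r t] /= []; rewrite !in_itv/= !andbT => r0 t0.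
  by rewrite [in X in a X]max_l// max_l// arg_ge0.
- move=> t t0; apply: (@class_K_intro _ _ (fun r =>
    i (Num.max (expR (c - t) * a (Num.max r 0)) 0))).
  + move=> r; apply: (@cvg_comp _ _ _ (fun r =>
      expR (c - t) * a (Num.max r 0)) (fun r => i (Num.max r 0))); last exact: ic.
    by apply: cvgM; [exact: cvg_cst|exact: ac].
  + by move=> r r0; rewrite [in X in a X]max_l// max_l// arg_ge0.
  + move=> r s r0 rs; apply: class_K_lt iK.1 _ _; first exact: arg_ge0.
    by rewrite ltr_pM2l ?expR_gt0//; exact: class_K_lt aK.1 _ _.
  + by rewrite a0 mulr0.
- move=> r r0 s t _ _ st; apply: class_K_le iK.1 _ _; first exact: arg_ge0.
  by rewrite ler_wpM2r ?a_ge0// ler_expR lerB.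
- move=> r r0.
  have e0 : expR (c - t) * a r @[t --> +oo] --> 0.
    rewrite -[X in _ --> X](mul0r (a r)); apply: cvgM; last exact: cvg_cst.
    have -> : (fun t => expR (c - t)) = (fun t => expR c * expR (- t)).
      by apply/funext => t; rewrite expRD.
    rewrite -[X in _ --> X](mulr0 (expR c)).
    by apply: cvgM; [exact: cvg_cst|exact: cvgr_expR].
  have := @cvg_comp _ _ _ _ (fun r => i (Num.max r 0)) _ _ _ e0 (@ic 0).
  rewrite maxxx i0; apply: cvg_trans; apply: near_eq_cvg.
  by apply: nearW => t; rewrite /= max_l// arg_ge0.
Qed.

End KL.

(** * The Euclidean norm and Gronwall's inequality *)

Section EuclideanNorm.
Variables (R : realType) (n : nat).
Implicit Types x y z : 'rV[R]_n.

Lemma sqr_enorm x : enorm x ^+ 2 = \sum_(i < n) x ord0 i ^+ 2.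
Proof. by rewrite sqr_sqrtr// sumr_ge0// => i _; exact: sqr_ge0. Qed.

Lemma enorm_ge0 x : 0 <= enorm x.
Proof. exact: sqrtr_ge0. Qed.
Hint Resolve enorm_ge0 : core.

Lemma enorm0 : enorm (0 : 'rV[R]_n) = 0.
Proof.
rewrite /enorm big1 ?sqrtr0// => i _.
by rewrite mxE expr0n.
Qed.

Lemma enormN x : enorm (- x) = enorm x.
Proof. by congr Num.sqrt; apply: eq_bigr => i _; rewrite mxE sqrrN. Qed.

Lemma coord_le_enorm x i : `|x ord0 i| <= enorm x.
Proof.
rewrite -sqrtr_sqr ler_wsqrtr// (bigD1 i)//= lerDl.
by apply: sumr_ge0 => j _; exact: sqr_ge0.
Qed.

Lemma enorm0_eq0 x : enorm x = 0 -> x = 0.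
Proof.
move=> x0; apply/rowP => i; rewrite mxE; apply/eqP.
by rewrite -normr_le0 -x0 coord_le_enorm.
Qed.

Lemma norm_le_enorm x : `|x| <= enorm x.
Proof.
rewrite /Num.Def.normr/= mx_normrE bigmax_le// => -[i j] _ /=.
by rewrite (ord1 i) coord_le_enorm.
Qed.

Lemma coord_le_norm x i : `|x ord0 i| <= `|x|.
Proof. by rewrite [leRHS]/Num.Def.normr/= mx_normrE (le_bigmax _ _ (ord0, i)). Qed.

(** The constant is not sharp; only the equivalence of the two norms matters. *)
Lemma enorm_le_norm x : enorm x <= n.+1%:R * `|x|.
Proof.
have h : 0 <= n.+1%:R * `|x| by rewrite mulr_ge0.
rewrite -(@ler_pXn2r _ 2) ?nnegrE// sqr_enorm exprMn.
apply: (@le_trans _ _ (\sum_(i < n) `|x| ^+ 2)).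
  apply: ler_sum => i _; rewrite -real_normK ?num_real//.
  by rewrite ler_pXn2r ?nnegrE// coord_le_norm.
rewrite sumr_const card_ord -[leLHS]mulr_natl ler_wpM2r ?exprn_ge0//.
by rewrite -natrX ler_nat; apply: leq_trans (leqnSn n) _; rewrite leq_pmulr.
Qed.

Lemma cauchy_schwarz x y : \sum_(i < n) x ord0 i * y ord0 i <= enorm x * enorm y.
Proof.
have [x0|x0] := eqVneq (enorm x) 0.
  rewrite (enorm0_eq0 x0) big1 ?enorm0 ?mul0r// => i _.
  by rewrite mxE mul0r.
have [y0|y0] := eqVneq (enorm y) 0.
  rewrite (enorm0_eq0 y0) big1 ?enorm0 ?mulr0// => i _.
  by rewrite mxE mulr0.
have xy0 : 0 < enorm x * enorm y by rewrite mulr_gt0// lt_def enorm_ge0 andbT.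
set d := \sum_(i < n) _.
have : 0 <= \sum_(i < n) (enorm y * x ord0 i - enorm x * y ord0 i) ^+ 2.
  by apply: sumr_ge0 => i _; exact: sqr_ge0.
have -> : \sum_(i < n) (enorm y * x ord0 i - enorm x * y ord0 i) ^+ 2 =
    enorm y ^+ 2 * enorm x ^+ 2 + enorm x ^+ 2 * enorm y ^+ 2
    - 2 * (enorm x * enorm y) * d.
  rewrite {1}(sqr_enorm x) {2}(sqr_enorm y) /d !mulr_sumr -sumrN -!big_split/=.
  by apply: eq_bigr => i _; ring.
by move=> h; rewrite -(ler_pM2l xy0); lra.
Qed.

Lemma ler_enormD x y : enorm (x + y) <= enorm x + enorm y.
Proof.
rewrite -(@ler_pXn2r _ 2) ?nnegrE ?addr_ge0// sqr_enorm.
have -> : \sum_(i < n) (x + y) ord0 i ^+ 2 =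
    enorm x ^+ 2 + enorm y ^+ 2 + 2 * \sum_(i < n) x ord0 i * y ord0 i.
  rewrite !sqr_enorm mulr_sumr -!big_split/=.
  by apply: eq_bigr => i _; rewrite mxE; ring.
have := cauchy_schwarz x y; lra.
Qed.

Lemma enorm_lip x y : enorm x <= enorm y + enorm (x - y).
Proof. by rewrite -{1}(subrK y x) addrC ler_enormD. Qed.

Lemma enorm_distC x y : enorm (x - y) = enorm (y - x).
Proof. by rewrite -enormN opprB. Qed.

Lemma near_enorm x (e : R) : 0 < e -> \forall y \near x, enorm (y - x) < e.
Proof.
move=> e0; have e' : 0 < e / n.+1%:R by rewrite divr_gt0.
apply/nbhs_ballP; exists (e / n.+1%:R) => //= y; rewrite mx_norm_ball /ball_ /=.
rewrite distrC ltr_pdivlMr// => h; apply: le_lt_trans (enorm_le_norm _) _.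
by rewrite mulrC.
Qed.

Lemma enorm_continuous : continuous (@enorm R n).
Proof.
move=> x; apply: (@cvg_two_sided R _ (nbhs x)) => e e0.
near=> y; have yx : enorm (y - x) < e by near: y; exact: near_enorm.
have := enorm_lip x y; rewrite enorm_distC; have := enorm_lip y x.
by split; lra.
Unshelve. all: by end_near.
Qed.

Lemma nbhs_enorm x (U : set 'rV[R]_n) : nbhs x U ->
  exists2 e, 0 < e & forall y, enorm (y - x) < e -> U y.
Proof.
move=> /nbhs_ballP[e /= e0 eU]; exists e => // y yx; apply: eU.
rewrite mx_norm_ball /ball_ /= distrC.
exact: le_lt_trans (norm_le_enorm _) yx.
Qed.

Lemma enorm_ball_compact (r : R) : compact [set x : 'rV[R]_n | enorm x <= r].
Proof.
apply: bounded_closed_compact.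
  exists r; split; first exact: num_real.
  move=> s rs x /= xr; apply: le_trans (norm_le_enorm x) _.
  exact: le_trans xr (ltW rs).
apply: (@closed_comp _ _ (@enorm R n) [set s | s <= r]).
  by move=> x _; exact: enorm_continuous.
exact: closed_le.
Qed.

Lemma class_K_enorm_continuous (a : R -> R) : class_K a ->
  continuous (fun x : 'rV[R]_n => a (enorm x)).
Proof.
move=> aK; have -> : (fun x : 'rV[R]_n => a (enorm x)) =
    (fun r => a (Num.max r 0)) \o (@enorm R n).
  by apply/funext => x /=; rewrite max_l ?enorm_ge0.
move=> x; apply: (@cvg_comp _ _ _ (@enorm R n)); first exact: enorm_continuous.
exact: class_K_extend.
Qed.

End EuclideanNorm.
#[global] Hint Resolve enorm_ge0 : core.

Section Gronwall.
Variables (R : realType) (n : nat).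

Lemma is_derive_coord (y : R -> 'rV[R]_n) (t : R) (v : 'rV[R]_n) i :
  is_derive t 1 y v -> is_derive t 1 (fun u => y u ord0 i) (v ord0 i).
Proof.
move=> [dy <-]; apply: DeriveDef; first exact: ((derivable_mxP y t 1).1 dy).
by rewrite derive_mx// mxE.
Qed.

Lemma is_derive_continuous (V : normedModType R) (y : R -> V) (t : R) (v : V) :
  is_derive t 1 y v -> {for t, continuous y}.
Proof. by move=> [dy _]; exact/differentiable_continuous/derivable1_diffP. Qed.

(** By the Cauchy-Schwarz inequality the squared distance of [u] and [v] grows
    at rate at most [2 * L], so its product with [exp (- 2 L t)] decreases. *)
Lemma gronwall (u v u' v' : R -> 'rV[R]_n) (a b L : R) : a <= b ->
  {within `[a, b], continuous u} -> {within `[a, b], continuous v} ->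
  (forall t, t \in `]a, b[ -> is_derive t 1 u (u' t)) ->
  (forall t, t \in `]a, b[ -> is_derive t 1 v (v' t)) ->
  (forall t, t \in `]a, b[ ->
     enorm (u' t - v' t) <= L * enorm (u t - v t)) ->
  enorm (u b - v b) <= expR (L * (b - a)) * enorm (u a - v a).
Proof.
move=> ab uc vc du dv lip.
pose E t := \sum_(i < n) (u t ord0 i - v t ord0 i) ^+ 2.
have EE t : E t = enorm (u t - v t) ^+ 2.
  by rewrite sqr_enorm; apply: eq_bigr => i _; rewrite !mxE.
pose W t := expR (- (2 * L * t)) * E t.
pose E' t :=
  \sum_(i < n) 2 * (u t ord0 i - v t ord0 i) * (u' t ord0 i - v' t ord0 i).
pose W' t := expR (- (2 * L * t)) * (E' t - 2 * L * E t).
have dW t : t \in `]a, b[ -> is_derive t 1 W (W' t).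
  move=> tab.
  have dE : is_derive t 1 E (E' t).
    have -> : E = \sum_(i < n) (fun t => u t ord0 i - v t ord0 i) ^+ 2.
      by apply/funext => s; rewrite /E fct_sumE.
    apply: is_derive_sum => i.
    have dui := is_derive_coord i (du _ tab).
    have dvi := is_derive_coord i (dv _ tab).
    have h := is_deriveX 2 (is_deriveB dui dvi).
    apply: is_derive_eq h _.
    by rewrite /= expr1.
  have dexp : is_derive t 1 (fun t => expR (- (2 * L * t)))
      (expR (- (2 * L * t)) * (- (2 * L))).
    have dl : is_derive t 1 (fun t : R => - (2 * L * t)) (- (2 * L)).
      have h := is_deriveN (is_deriveZ (2 * L) (is_derive_id t (1 : R))).
      apply: is_derive_eq h _.
      by rewrite /GRing.scale/= mulr1.
    have h := is_derive1_comp (g := fun t : R => - (2 * L * t))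
      (is_derive_expR (- (2 * L * t))) dl.
    apply: is_derive_eq h _.
    by [].
  apply: is_derive_eq (is_deriveM dexp dE) _.
  rewrite /W' /GRing.scale/=; ring.
have W'le0 t : t \in `]a, b[ -> W' t <= 0.
  move=> tab; rewrite mulr_ge0_le0 ?expR_ge0// subr_le0.
  have -> : E' t = 2 * \sum_(i < n) (u t - v t) ord0 i * (u' t - v' t) ord0 i.
    by rewrite mulr_sumr; apply: eq_bigr => i _; rewrite !mxE; ring.
  rewrite -mulrA ler_pM2l// EE; apply: le_trans (cauchy_schwarz _ _) _.
  by rewrite expr2 mulrCA ler_wpM2l ?enorm_ge0 ?lip.
have Wc : {within `[a, b], continuous W}.
  move=> t; apply: cvgM.
    apply: continuous_subspaceT => s.
    apply: (@cvg_comp _ _ _ (fun s : R => - (2 * L * s)) expR); last first.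
      exact: continuous_expR.
    by apply: cvgN; apply: cvgM; [exact: cvg_cst|exact: cvg_id].
  have -> : (E : subspace `[a, b]%classic -> R) =
      (fun t : subspace `[a, b]%classic => enorm (u t - v t) ^+ 2) by apply/funext.
  apply: (@cvg_comp _ _ _ (fun t : subspace `[a, b]%classic => u t - v t)
    (fun x => enorm x ^+ 2) _ (nbhs (u t - v t))).
    by apply: cvgB; [exact: uc|exact: vc].
  by apply: cvgM; exact: enorm_continuous.
have Wab : W b <= W a.
  apply: (@ler0_derive1_le_cc R W a b) => //.
  - by move=> t /dW[].
  - by move=> t tab; rewrite derive1E (@derive_val _ _ _ _ _ _ _ (dW _ tab)) W'le0.
  - by rewrite in_itv/= lexx ab.
  - by rewrite in_itv/= lexx ab.
rewrite -(@ler_pXn2r _ 2) ?nnegrE ?mulr_ge0 ?expR_ge0 ?enorm_ge0// exprMn -!EE.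
have -> : expR (L * (b - a)) ^+ 2 = expR (2 * L * b) * expR (- (2 * L * a)).
  by rewrite -expRD -expRM_natl; congr expR; ring.
have -> : E b = expR (2 * L * b) * W b.
  by rewrite /W mulrA -expRD subrr expR0 mul1r.
by rewrite -[leRHS]mulrA ler_pM2l ?expR_gt0.
Qed.

End Gronwall.

(** * Flows of locally Lipschitz vector fields *)

Section Uniform.
Variable R : realType.

Lemma cvg_near_eq (T S : topologicalType) (F : set_system T) (FF : Filter F)
    (g z : T -> S) (l : S) :
  (\forall v \near F, g v = z v) -> g @ F --> l -> z @ F --> l.
Proof. by move=> h; apply: cvg_trans; exact: near_eq_cvg. Qed.

(** Finitely many of the local constants suffice on a compact set. *)
Lemma compact_uniform (T : topologicalType) (K : set T) (Q : R -> T -> Prop) :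
  compact K -> (forall x B B', B <= B' -> Q B x -> Q B' x) ->
  (forall x, K x -> exists B, \forall y \near x, Q B y) ->
  exists B, forall x, K x -> Q B x.
Proof.
move=> /compact_near_coveringP cK mono loc.

have h : \forall B \near +oo, K `<=` Q B.
  apply: cK => x /loc[B BQ].
  exists ([set y | Q B y], [set B' | B <= B']).
    by split => //=; apply: nbhs_pinfty_ge; exact: num_real.
  by move=> [y B'] /= [yQ BB']; exact: mono yQ.
have [B BK] := filter_ex h.
by exists B.
Qed.

Lemma finite_uniform (I : finType) (P : I -> R -> Prop) :
  (forall i L L', L <= L' -> P i L -> P i L') -> (forall i, exists L, P i L) ->
  exists L, forall i, P i L.
Proof.
move=> mono ex; have h : \forall L \near +oo, forall i, P i L.
  apply: filter_forall => i; have [L PL] := ex i; near=> L'.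
  by apply: mono PL; near: L'; apply: nbhs_pinfty_ge; exact: num_real.
by have [L PL] := filter_ex h; exists L.
Unshelve. all: by end_near.
Qed.

Lemma first_hit (g : R -> R) (c t : R) : continuous g -> 0 <= t -> c <= g t ->
  exists s, [/\ 0 <= s <= t, c <= g s & forall u, 0 <= u < s -> g u < c].
Proof.
move=> gc t0 ct; pose A := `[0, t] `&` (g @^-1` [set r | c <= r]).
have [||//|s /set_mem[/= st cs] smin] := @compact_EVT_min R R (fun s => s) A.
- by exists t; split => //=; rewrite in_itv/= t0 lexx.
- apply: compact_closedI; first exact: segment_compact.
  by apply: closed_comp => [s _|]; [exact: gc|exact: closed_ge].
- by move=> s; apply: continuous_subspaceT => u; exact: cvg_id.
exists s; split => //.
move=> u /andP[u0 us]; rewrite ltNge; apply/negP => cu.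
have : s <= u; last by rewrite leNgt us.
apply: smin; apply/mem_set; split => //=; rewrite in_itv/= u0/=.
by move: st; rewrite in_itv/= => /andP[_]; apply: le_trans (ltW us).
Qed.
End Uniform.

Section LocallyLipschitz.
Variables (R : realType) (n : nat) (f : 'rV[R]_n -> 'rV[R]_n).
Hypothesis f_lip : locally_lipschitz f.

Lemma locally_lipschitz_enorm x : exists L r : R, [/\ 0 <= L, 0 < r &
  forall y z, enorm (y - x) < r -> enorm (z - x) < r ->
    enorm (f y - f z) <= L * enorm (y - z)].
Proof.
have [U /nbhs_enorm[r r0 rU] Ulip] := f_lip x.
have [k kP] := @filter_ex R (pinfty_nbhs R) _ _ Ulip.
exists (n.+1%:R * Num.max k 0), r; split => //.
  by rewrite mulr_ge0// le_max lexx orbT.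
move=> y z /rU Uy /rU Uz; apply: le_trans (enorm_le_norm _) _.
rewrite -mulrA ler_wpM2l//; have := kP (y, z) (conj Uy Uz); rewrite /=.
move=> h; apply: le_trans h _; apply: (@le_trans _ _ (Num.max k 0 * `|y - z|)).
  by rewrite ler_wpM2r// le_max lexx.
by rewrite ler_wpM2l ?norm_le_enorm// le_max lexx orbT.
Qed.

(** Near each point pairs of close points are handled by the local constant; for
    pairs at a distance bounded below, boundedness of [f] on the ball is
    enough. *)
Lemma locally_lipschitz_ball rho : exists2 L : R, 0 <= L &
  forall x y, enorm x <= rho -> enorm y <= rho ->
    enorm (f x - f y) <= L * enorm (x - y).
Proof.
have [B BP] : exists B, forall x, enorm x <= rho -> enorm (f x) <= B.
  apply: (@compact_uniform R _ [set x | enorm x <= rho]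
    (fun B x => enorm (f x) <= B)).
  - exact: enorm_ball_compact.
  - by move=> x B B' BB' h; exact: le_trans h BB'.
  move=> x _; have [L [r [L0 r0 lipx]]] := locally_lipschitz_enorm x.
  exists (enorm (f x) + L * r); near=> y.
  have yx : enorm (y - x) < r by near: y; exact: near_enorm.
  apply: le_trans (enorm_lip _ (f x)) _; rewrite lerD2l.
  apply: le_trans (lipx y x _ _) _ => //; first by rewrite subrr enorm0.
  by rewrite ler_wpM2l// ltW.
have [L LP] : exists L, forall x, enorm x <= rho ->
    0 <= L /\ forall y, enorm y <= rho ->
    enorm (f x - f y) <= L * enorm (x - y).
  suff [L LP] : exists L, forall x, enorm x <= rho -> enorm x <= rho ->
      0 <= L /\ forall y, enorm y <= rho ->
      enorm (f x - f y) <= L * enorm (x - y).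
    by exists L => x xrho; exact: LP.
  apply: (@compact_uniform R _ [set x | enorm x <= rho] (fun L x =>
    enorm x <= rho -> 0 <= L /\ forall y, enorm y <= rho ->
    enorm (f x - f y) <= L * enorm (x - y))).
  - exact: enorm_ball_compact.
  - move=> x L L' LL' h /h[L0 {}h]; split; first exact: le_trans LL'.
    by move=> y /h{}h; apply: le_trans h _; rewrite ler_wpM2r ?enorm_ge0.
  move=> x xrho; have [L [r [L0 r0 lipx]]] := locally_lipschitz_enorm x.
  have B0 : 0 <= B by apply: le_trans (BP x xrho); exact: enorm_ge0.
  have r2 : 0 < r / 2 by rewrite divr_gt0.
  (* Points outside the ball of radius [r] are at distance at least [r / 2]
     from [z]. *)
  exists (L + 2 * B / (r / 2)); near=> z => zrho.
  have zx : enorm (z - x) < r / 2 by near: z; exact: near_enorm.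
  have h0 : 0 <= 2 * B / (r / 2) by rewrite divr_ge0 ?mulr_ge0// ltW.
  split; first by rewrite addr_ge0.
  move=> y yrho; have [yx|xy] := ltP (enorm (y - x)) r.
    apply: le_trans (lipx z y _ yx) _; first by apply: lt_trans zx _; lra.
    by rewrite ler_wpM2r ?enorm_ge0// lerDl.
  have zy : r / 2 <= enorm (z - y).
    have := ler_enormD (y - z) (z - x); rewrite addrA subrK (enorm_distC y z).
    lra.
  apply: (@le_trans _ _ (2 * B)).
    apply: le_trans (ler_enormD _ _) _; rewrite enormN mulr_natl mulr2n.
    by rewrite lerD// BP.
  apply: (@le_trans _ _ (2 * B / (r / 2) * enorm (z - y))).
    rewrite mulrAC ler_pdivlMr// ler_wpM2l// mulr_ge0//.
  by rewrite ler_wpM2r ?enorm_ge0// lerDr.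
have [/LP[L0 _]|rho0] := boolP (enorm (0 : 'rV[R]_n) <= rho).
  by exists L => // x y /LP[_]; apply.
exists 0 => // x y xr; rewrite enorm0 -ltNge in rho0.
by have := le_lt_trans xr rho0; rewrite ltNge enorm_ge0.
Unshelve. all: by end_near.
Qed.

End LocallyLipschitz.

Section Flow.
Variables (R : realType) (n : nat) (f : 'rV[R]_n -> 'rV[R]_n).
Variable phi : R -> 'rV[R]_n -> 'rV[R]_n.
Hypotheses (f_lip : locally_lipschitz f) (f_flow : is_flow f phi).

Lemma flow0 (x : 'rV[R]_n) : phi 0 x = x. Proof. by have [] := f_flow x. Qed.

Lemma flow_derive x (t : R) : is_derive t 1 (phi ^~ x) (f (phi t x)).
Proof. by have [_ + _] := f_flow x; exact. Qed.

Lemma flow_continuous (x : 'rV[R]_n) : continuous (phi ^~ x).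
Proof. by move=> t; exact: is_derive_continuous (flow_derive x t). Qed.

Lemma is_derive_translate (y : R -> 'rV[R]_n) (a t : R) v :
  is_derive (t + a) 1 y v -> is_derive t 1 (fun u => y (u + a)) v.
Proof.
have e : (fun h : R => h^-1 *: (y (h *: 1 + t + a) - y (t + a))) =
         (fun h : R => h^-1 *: (y (h *: 1 + (t + a)) - y (t + a))).
  by apply/funext => h; rewrite addrA.
move=> [dy vy]; split.
  by rewrite /derivable /= /shift/= e.
by rewrite -vy /derive /= /shift/= e.
Qed.

Lemma flowD (s t : R) (x : 'rV[R]_n) : phi (t + s) x = phi t (phi s x).
Proof.
have [_ _] := f_flow (phi s x); move=> /(_ (fun t => phi (t + s) x)); apply.
  by move=> u; apply: is_derive_translate (flow_derive x (u + s)).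
by rewrite add0r.
Qed.

Lemma flow_fix0 (t : R) : f 0 = 0 -> phi t 0 = 0.
Proof.
move=> f0; have [_ _ /(_ (cst 0)) h] := f_flow 0.
rewrite -h// => u; rewrite /cst f0; exact: is_derive_cst.
Qed.

Lemma flow_dist (rho L t : R) (x y : 'rV[R]_n) : 0 <= t ->
  (forall x y, enorm x <= rho -> enorm y <= rho ->
    enorm (f x - f y) <= L * enorm (x - y)) ->
  (forall s, 0 <= s < t -> enorm (phi s x) <= rho /\ enorm (phi s y) <= rho) ->
  enorm (phi t x - phi t y) <= expR (L * t) * enorm (x - y).
Proof.
move=> t0 lip bnd.
have := @gronwall R n (phi ^~ x) (phi ^~ y) (fun s => f (phi s x))
  (fun s => f (phi s y)) 0 t L t0.
rewrite !flow0 subr0; apply.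
- by apply: continuous_subspaceT; exact: flow_continuous.
- by apply: continuous_subspaceT; exact: flow_continuous.
- by move=> s _; exact: flow_derive.
- by move=> s _; exact: flow_derive.
- move=> s; rewrite in_itv/= => /andP[s0 st].
  have [|h1 h2] := bnd s; first by rewrite (ltW s0).
  exact: lip.
Qed.

(** The uniqueness part of [is_flow] only speaks of solutions defined for all
    times. Local uniqueness comes from Gronwall instead, a continuous curve on a
    segment staying in a ball, where [f] is Lipschitz. *)
Lemma flow_segment (z : R -> 'rV[R]_n) (a b : R) : a <= b ->
  {within `[a, b], continuous z} ->
  (forall t, t \in `]a, b[ -> is_derive t 1 z (f (z t))) ->
  z b = phi (b - a) (z a).
Proof.
move=> ab zc dz; pose v t := phi (t - a) (z a).
have vc : {within `[a, b], continuous v}.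
  apply: continuous_subspaceT => t.
  apply: (@cvg_comp _ _ _ (fun t => t - a) (phi ^~ (z a))).
    by apply: cvgB; [exact: cvg_id|exact: cvg_cst].
  exact: flow_continuous.
have bnd (w : R -> 'rV[R]_n) : {within `[a, b], continuous w} ->
    exists B : R, forall t, t \in `[a, b] -> enorm (w t) <= B.
  move=> wc; have [|c _ cP] := @EVT_max R (fun t => enorm (w t)) a b ab.
    move=> t; apply: (@cvg_comp _ _ _ (w : subspace `[a, b]%classic -> _)
      (@enorm R n) _ (nbhs (w t))); first exact: wc.
    exact: enorm_continuous.
  by exists (enorm (w c)).
have [Bz BzP] := bnd z zc; have [Bv BvP] := bnd v vc.
have [L L0 LP] := locally_lipschitz_ball f_lip (Num.max Bz Bv).
have : enorm (z b - v b) <= expR (L * (b - a)) * enorm (z a - v a).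
  apply: (@gronwall R n z v (fun t => f (z t)) (fun t => f (v t))) => //.
    by move=> t _; apply: (@is_derive_translate (phi ^~ (z a)) (- a) t);
       exact: flow_derive.
  move=> t tab; have tab' : t \in `[a, b] by exact: subset_itv_oo_cc.
  by apply: LP; rewrite le_max (BzP, BvP)// orbT.
rewrite {2}/v subrr flow0 subrr enorm0 mulr0 => h.
apply/eqP; rewrite -subr_eq0; apply/eqP/enorm0_eq0/eqP.
by rewrite eq_le h enorm_ge0.
Qed.

(** Nearby trajectories cannot separate before time [T]: up to the first instant
    at which their distance reaches 1, Gronwall applies with a single constant
    and keeps the distance below 1. *)
Lemma flow_near (T : R) (x0 : 'rV[R]_n) : 0 <= T ->
  exists C r : R, [/\ 0 <= C, 0 < r &
  forall x t, enorm (x - x0) < r -> 0 <= t <= T ->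
    enorm (phi t x - phi t x0) <= C * enorm (x - x0)].
Proof.
move=> T0.
have [c _ cP] : exists2 c, c \in `[0, T] & forall t, t \in `[0, T] ->
    enorm (phi t x0) <= enorm (phi c x0).
  apply: (@EVT_max R (fun t => enorm (phi t x0))) => //.
  apply: continuous_subspaceT => t.
  apply: (@cvg_comp _ _ _ (phi ^~ x0)); first exact: flow_continuous.
  exact: enorm_continuous.
pose rho := enorm (phi c x0) + 1.
have [L L0 LP] := locally_lipschitz_ball f_lip rho.
have x0rho t : 0 <= t <= T -> enorm (phi t x0) <= enorm (phi c x0).
  by move=> tT; apply: cP; rewrite in_itv.
exists (expR (L * T)), (expR (L * T))^-1; split;
  rewrite ?expR_ge0 ?invr_gt0 ?expR_gt0//.
move=> x t xr tT.
have dist s : 0 <= s <= T ->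
    (forall u, 0 <= u < s -> enorm (phi u x - phi u x0) < 1) ->
    enorm (phi s x - phi s x0) <= expR (L * T) * enorm (x - x0).
  move=> /andP[s0 sT] close.
  apply: (@le_trans _ _ (expR (L * s) * enorm (x - x0))).
    apply: (@flow_dist rho) => // u /andP[u0 us].
    have uT : 0 <= u <= T by rewrite u0 (le_trans (ltW us)).
    have := x0rho _ uT; have := close u; rewrite u0 us => /(_ isT).
    by have := enorm_lip (phi u x) (phi u x0); rewrite /rho; lra.
  by rewrite ler_wpM2r ?enorm_ge0// ler_expR ler_wpM2l.
apply: (dist) => // u /andP[u0 ut]; rewrite ltNge; apply/negP => hit.
have [|//|//|s [/andP[s0 su] hs before]] :=
    @first_hit R (fun s => enorm (phi s x - phi s x0)) 1 u.
  move=> s; apply: (@cvg_comp _ _ _ (fun s => phi s x - phi s x0));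
    last exact: enorm_continuous.
  by apply: cvgB; exact: flow_continuous.
have sT : 0 <= s <= T.
  by move: tT; rewrite s0 => /andP[_]; apply: le_trans (le_trans su (ltW ut)).
have := dist s sT before; apply/negP; rewrite -ltNge; apply: lt_le_trans hs.
by rewrite -ltr_pdivlMl ?expR_gt0// mulr1.
Qed.

(** Immediate near each initial state by [flow_near]; compactness of balls makes
    the bound uniform. *)
Lemma flow_bound (T rho : R) : 0 <= T -> exists B : R, forall x t,
  enorm x <= rho -> 0 <= t <= T -> enorm (phi t x) <= B.
Proof.
move=> T0.
suff [B BP] : exists B, forall x, enorm x <= rho ->
    forall t, 0 <= t <= T -> enorm (phi t x) <= B by exists B => x t /BP; apply.
apply: (@compact_uniform R _ [set x | enorm x <= rho] (fun B x =>
    forall t, 0 <= t <= T -> enorm (phi t x) <= B)).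
- exact: enorm_ball_compact.
- by move=> x B B' BB' h t /h{}h; exact: le_trans h BB'.
move=> x0 _; have [C [r [C0 r0 near_x0]]] := flow_near x0 T0.
have [c _ cP] : exists2 c, c \in `[0, T] & forall t, t \in `[0, T] ->
    enorm (phi t x0) <= enorm (phi c x0).
  apply: (@EVT_max R (fun t => enorm (phi t x0))) => //.
  apply: continuous_subspaceT => t.
  apply: (@cvg_comp _ _ _ (phi ^~ x0)); first exact: flow_continuous.
  exact: enorm_continuous.
exists (enorm (phi c x0) + C * r); near=> x => t tT.
have xr : enorm (x - x0) < r by near: x; exact: near_enorm.
apply: le_trans (enorm_lip _ (phi t x0)) _; apply: lerD.
  by apply: cP; rewrite in_itv.
by apply: le_trans (near_x0 _ _ xr tT) _; rewrite ler_wpM2l// ltW.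
Unshelve. all: by end_near.
Qed.

(** Equicontinuity in the state, from [flow_near], combined with continuity in
    time for one fixed state. *)
Lemma flow_joint_continuous (T t e : R) (x : 'rV[R]_n) : 0 <= t <= T -> 0 < e ->
  exists2 r, 0 < r & forall s y, 0 <= s <= T -> `|s - t| < r ->
    enorm (y - x) < r -> enorm (phi s y - phi t x) < e.
Proof.
move=> /andP[t0 tT] e0.
have [C [r1 [C0 r10 near_x]]] := flow_near x (le_trans t0 tT).
have e2 : 0 < e / 2 by rewrite divr_gt0.
have [r2 /= r20 near_t] : exists2 r, 0 < r &
    forall s, `|t - s| < r -> enorm (phi s x - phi t x) < e / 2.
  have : \forall s \near t, enorm (phi s x - phi t x) < e / 2.
    exact: (@flow_continuous x t _ (near_enorm (phi t x) e2)).
  by move=> /nbhs_ballP[r r0 rP]; exists r.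
pose r3 := e / 2 / (C + 1).
have r30 : 0 < r3 by rewrite divr_gt0//; lra.
exists (Num.min r1 (Num.min r2 r3)); first by rewrite !lt_min r10 r20.
move=> s y sT; rewrite !lt_min => /and3P[_ st _] /and3P[yx1 _ yx3].
have h1 := near_x y s yx1 sT.
have h2 : enorm (phi s x - phi t x) < e / 2 by apply: near_t; rewrite distrC.
have h3 : C * enorm (y - x) <= e / 2.
  apply: (@le_trans _ _ ((C + 1) * enorm (y - x))).
    by rewrite ler_wpM2r ?enorm_ge0// lerDl.
  by rewrite mulrC -ler_pdivlMr ?ltW//; lra.
have := ler_enormD (phi s y - phi s x) (phi s x - phi t x).
by rewrite addrA subrK; lra.
Qed.

End Flow.

Section FlowFamily.
Variables (R : realType) (n M : nat).
Variable f : 'I_M -> 'rV[R]_n -> 'rV[R]_n.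
Variable Phi : 'I_M -> R -> 'rV[R]_n -> 'rV[R]_n.
Hypotheses (f_lip : forall i, locally_lipschitz (f i))
           (f0 : forall i, f i 0 = 0)
           (f_flow : forall i, is_flow (f i) (Phi i)).

(** A single comparison function measures how much the flows can enlarge the
    norm in bounded time; it goes through [Kinfty_minorant] because the flows
    are small near 0 and bounded on bounded sets. *)
Lemma flow_minorant T : 0 <= T ->
  exists2 w : R -> R, class_Kinfty w & forall i t x, 0 <= t <= T ->
    w (enorm (Phi i t x)) <= enorm x.
Proof.
move=> T0.
pose P := [set p : R * R | exists i t x, [/\ 0 <= t <= T,
  p.1 = enorm (Phi i t x) & p.2 = enorm x]].
have [|||w [wK _ wP]] := @Kinfty_minorant R P.
- by move=> p [i [t [x [_ _ ->]]]].
- move=> s s0.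
  have [L LP] : exists L, forall i, 0 < L /\ forall t x, 0 <= t <= T ->
      enorm x < L^-1 -> enorm (Phi i t x) < s.
    apply: finite_uniform => [i L L' LL' [L0 h]|i].
      have L'0 := lt_le_trans L0 LL'; split => // t x tT xL; apply: h => //.
      by apply: lt_le_trans xL _; rewrite lef_pV2 ?posrE.
    have [C [r [C0 r0 near0]]] := flow_near (f_lip i) (f_flow i) 0 T0.
    exists (r^-1 + (C + 1) / s); split.
      by rewrite addr_gt0 ?invr_gt0// divr_gt0//; lra.
    have d0 : 0 < (C + 1) / s by rewrite divr_gt0//; lra.
    move=> t x tT xr.
    have xr1 : enorm x < r.
      apply: lt_le_trans xr _; rewrite -[leRHS]invrK lef_pV2 ?posrE ?invr_gt0//.
        by rewrite lerDl ltW.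
      by rewrite addr_gt0 ?invr_gt0.
    have xr2 : enorm x < s / (C + 1).
      apply: lt_le_trans xr _; rewrite -[leRHS]invf_div lef_pV2 ?posrE//.
        by rewrite lerDr ltW ?invr_gt0.
      by rewrite addr_gt0 ?invr_gt0.
    have := near0 x t; rewrite subr0 (flow_fix0 (f_flow i))// subr0.
    move=> /(_ xr1 tT) h; apply: le_lt_trans h _.
    apply: (@le_lt_trans _ _ ((C + 1) * enorm x)).
      by rewrite ler_wpM2r ?enorm_ge0// lerDl.
    by rewrite mulrC -ltr_pdivlMr//; lra.
  have [[i0 _]|noI] := pselect (exists i : 'I_M, True); last first.
    by exists 1 => // p [i]; exfalso; apply: noI; exists i.
  exists L^-1; first by rewrite invr_gt0; have [] := LP i0.
  by move=> p [i [t [x [tT -> ->]]]]; have [_] := LP i; exact.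
- move=> B.
  have [S SP] : exists S, forall i, forall t x, 0 <= t <= T ->
      enorm x <= B -> enorm (Phi i t x) < S.
    apply: finite_uniform => [i L L' LL' h t x tT xB|i].
      by apply: lt_le_trans LL'; exact: h.
    have [C CP] := flow_bound (f_lip i) (f_flow i) B T0.
    by exists (C + 1) => t x tT xB; rewrite (le_lt_trans (CP _ _ xB tT))// ltrDl.
  exists S => p [i [t [x [tT -> ->]]]] xB.
  by apply: SP => //; exact: ltW.
exists w => // i t x tT.
have Pp : P (enorm (Phi i t x), enorm x) by exists i, t, x.
by have := wP _ Pp; apply; exact: enorm_ge0.
Qed.

End FlowFamily.

(** * Switching signals and dwell schedules *)

Section TimeGrid.
Variables (R : realType) (t : nat -> R).
Hypotheses (t0 : t 0%N = 0) (t_inc : {homo t : k l / (k < l)%N >-> k < l}).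
Hypothesis t_unb : forall T, exists k, T < t k.

Lemma grid_le k l : (k <= l)%N -> t k <= t l.
Proof. by rewrite leq_eqVlt => /predU1P[->//|/t_inc/ltW]. Qed.

Lemma grid_ge0 k : 0 <= t k.
Proof. by rewrite -t0 grid_le. Qed.

Lemma grid_cell_unique k l u : t k <= u < t k.+1 -> t l <= u < t l.+1 -> k = l.
Proof.
move=> /andP[ku uk] /andP[lu ul]; apply/eqP; rewrite eqn_leq.
apply/andP; split; rewrite -ltnS ltnNge; apply/negP => /grid_le.
  by apply/negP; rewrite -ltNge (le_lt_trans ku).
by apply/negP; rewrite -ltNge (le_lt_trans lu).
Qed.

(** Negative times are put in the first cell, so that everything defined
    cell by cell extends smoothly to the left of 0. *)
Lemma grid_cell : exists c : R -> nat,
  [/\ forall u, u < t (c u).+1, forall u, u < 0 -> c u = 0%N,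
    forall u, 0 <= u -> t (c u) <= u
    & forall k u, t k <= u < t k.+1 -> c u = k].
Proof.
have cell u : exists k, [/\ u < t k.+1, u < 0 -> k = 0%N & 0 <= u -> t k <= u].
  have [u0|u0] := ltP u 0.
    by exists 0%N; split => //; rewrite (lt_trans u0)// -t0 t_inc.
  have ex : exists k, u < t k.
    exact: t_unb.
  case: (ex_minnP ex) => -[|k] uk kmin; first by move: uk; rewrite t0 ltNge u0.
  exists k; split => // _; rewrite leNgt; apply/negP => /kmin.
  by rewrite ltnn.
have [c cP] := choice cell; exists c; split.
- by move=> u; have [] := cP u.
- by move=> u; have [] := cP u.
- by move=> u; have [] := cP u.
- move=> k u ku; apply: (@grid_cell_unique _ _ u) => //.
  have [-> _ ->//] := cP u.
  by case/andP: ku => ku _; exact: le_trans (grid_ge0 k) ku.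
Qed.

End TimeGrid.

Section Schedules.
Variables (R : realType) (n M : nat).
Variable Phi : 'I_M -> R -> 'rV[R]_n -> 'rV[R]_n.
Implicit Types (m : nat -> 'I_M) (d : nat -> R).

(** The state at the [k]-th switching instant of a schedule with modes [m] and
    dwells [d]. *)
Fixpoint visit m d (x : 'rV[R]_n) k : 'rV[R]_n :=
  if k is k'.+1 then Phi (m k') (d k') (visit m d x k') else x.

Definition elapsed d k : R := \sum_(j < k) d j.

Lemma elapsedS d k : elapsed d k.+1 = elapsed d k + d k.
Proof. by rewrite /elapsed big_ord_recr. Qed.

Lemma visit_tail m d x k :
  visit m d x k.+1 = visit (m \o S) (d \o S) (Phi (m 0%N) (d 0%N) x) k.
Proof. by elim: k => //= k ->. Qed.

Lemma elapsed_tail d k : elapsed d k.+1 = d 0%N + elapsed (d \o S) k.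
Proof. by rewrite /elapsed big_ord_recl. Qed.

Lemma eq_visit m m' d d' x k : (forall j, (j < k)%N -> m j = m' j) ->
  (forall j, (j < k)%N -> d j = d' j) -> visit m d x k = visit m' d' x k.
Proof.
elim: k => //= k IH mm' dd'; rewrite mm'// dd'// IH// => j jk.
  by rewrite mm'// ltnW.
by rewrite dd'// ltnW.
Qed.

End Schedules.

Section SignalFlow.
Variables (R : realType) (n M : nat).
Variable f : 'I_M -> 'rV[R]_n -> 'rV[R]_n.
Variable Phi : 'I_M -> R -> 'rV[R]_n -> 'rV[R]_n.
Hypotheses (f_lip : forall i, locally_lipschitz (f i))
           (f_flow : forall i, is_flow (f i) (Phi i)).

Section OneSignal.
Variables (s : R -> 'I_M) (t : nat -> R).
Hypotheses (s_signal : signals s) (s_t : enumerates_instants s t).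

Let t0 : t 0%N = 0. Proof. by case: s_t. Qed.
Let t_inc : {homo t : k l / (k < l)%N >-> k < l}. Proof. by case: s_t. Qed.
Let t_S k : t k < t k.+1. Proof. exact: t_inc. Qed.

(** Otherwise infinitely many switching instants would lie in a bounded
    interval. *)
Lemma instants_unbounded T : exists k, T < t k.
Proof.
apply: contrapT => bnd; have t_le k : t k <= T.
  by rewrite leNgt; apply/negP => Tk; apply: bnd; exists k.
have [/(_ T) fin _] := s_signal; apply: infinite_nat.
have t_inj : {in [set: nat] &, injective (fun k => t k.+1)}.
  move=> k l _ _ kl; case: (ltngtP k l) => // h.
    by have := @t_inc k.+1 l.+1 h; rewrite kl ltxx.
  by have := @t_inc l.+1 k.+1 h; rewrite kl ltxx.
rewrite -(eq_finite_set (inj_card_eq t_inj)).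
apply: sub_finite_set fin => _ [k _ <-]; split; last exact: t_le.
by have [_ _ ->] := s_t; exists k.
Qed.

(** A locally constant function on an interval is constant, which the mean value
    theorem shows when applied to the indicator function of a value. *)
Lemma signal_const k u : t k <= u < t k.+1 -> s u = s (t k).
Proof.
move=> /andP[]; rewrite le_eqVlt => /predU1P[<-//|ku uk].
have tk0 : 0 <= t k by exact: grid_ge0.
pose g (v : R) : R := (s v == s (t k))%:R.
have loc v : v \in `]t k, u[ -> \forall w \near v, s w = s v.
  rewrite in_itv/= => /andP[kv vu]; apply: contrapT => ns.
  have : switching_instants s v by split => //; exact: le_lt_trans kv.
  have [_ _ ->] := s_t; move=> [l _ lv].
  have kl : (k < l.+1)%N.
    rewrite ltnNge; apply/negP => /(grid_le t_inc); rewrite lv.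
    by rewrite leNgt kv.
  have := grid_le t_inc kl; rewrite lv leNgt.
  by rewrite (lt_trans vu).
have dg v : v \in `]t k, u[ -> is_derive v 1 g (cst 0 v).
  move=> /loc sv; apply: (@near_eq_is_derive _ _ _ (cst (g v))).
    by apply: filterS sv => w wv; rewrite /g /cst wv.
have su : \forall w \near u, s w = s u.
  apply: contrapT => ns.
  have : switching_instants s u by split => //; exact: le_lt_trans ku.
  have [_ _ ->] := s_t; move=> [l _ lv].
  have kl : (k < l.+1)%N.
    rewrite ltnNge; apply/negP => /(grid_le t_inc); rewrite lv.
    by rewrite leNgt ku.
  by have := grid_le t_inc kl; rewrite lv leNgt uk.
have gc : {within `[t k, u], continuous g}.
  apply/continuous_within_itvP => //; split.
  - move=> v /loc sv; apply: cvg_near_cst.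
    by apply: filterS sv => w wv; rewrite /g wv.
  - apply: cvg_near_cst; have := s_signal.2 _ tk0.
    by apply: filterS => w wv; rewrite /g wv.
  - apply: cvg_at_left_filter; apply: cvg_near_cst.
    by apply: filterS su => w wv; rewrite /g wv.
have [c _] := MVT ku dg gc; rewrite /cst mul0r /g eqxx.
by case: eqP => // _ /eqP; rewrite sub0r oppr_eq0 oner_eq0.
Qed.

Let m k := s (t k).
Let d k := t k.+1 - t k.

Lemma switched_solution_visit x z : switched_solution f s x z ->
  forall k r, 0 <= r <= d k -> z (t k + r) = Phi (m k) r (visit Phi m d x k).
Proof.
move=> [z0 zc dz] k r.
have step k' r' : 0 <= r' <= d k' -> z (t k' + r') = Phi (m k') r' (z (t k')).
  move=> /andP[r0 rd].
  have tk0 : 0 <= t k' by exact: grid_ge0.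
  have {2}-> : r' = t k' + r' - t k' by rewrite [t k' + r']addrC addrK.
  apply: (flow_segment (f_lip (m k')) (f_flow (m k'))).
  - by rewrite lerDl.
  - apply: continuous_subspaceW zc => u /=; rewrite !in_itv/= andbT => /andP[+ _].
    exact: le_trans.
  - move=> u; rewrite in_itv/= => /andP[ku uk].
  have uk1 : u < t k'.+1 by apply: lt_le_trans uk _; rewrite -lerBrDl.
  have <- : s u = m k' by apply: signal_const; rewrite uk1 (ltW ku).
  apply: dz; first exact: le_lt_trans ku.
  have [_ _ ->] := s_t; move=> [l _ lu].
  have kl : (k' < l.+1)%N.
    by rewrite ltnNge; apply/negP => /(grid_le t_inc); rewrite lu leNgt ku.
  by have := grid_le t_inc kl; rewrite lu leNgt uk1.
have -> : visit Phi m d x k = z (t k).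
  elim: k => [|k /= ->]; first by rewrite t0.
  rewrite -step; first by rewrite addrC subrK.
  by rewrite lexx andbT subr_ge0 ltW.
exact: step.
Qed.

(** The solutions of the successive modes are glued together. *)
Lemma switched_solution_exists x : exists z, switched_solution f s x z.
Proof.
have [c [c_lt c_neg c_le c_eq]] := grid_cell t0 t_inc instants_unbounded.
(* [A k] is the solution that enters mode [k] at the right instant, defined for
   all times; at [t k.+1] it meets [A k.+1]. *)
pose A k u := Phi (m k) (u - t k) (visit Phi m d x k).
pose z u := A (c u) u.
have Ac k : continuous (A k).
  move=> u; apply: (@cvg_comp _ _ _ (fun u => u - t k) (Phi (m k) ^~ _)).
    by apply: cvgB; [exact: cvg_id|exact: cvg_cst].
  exact: (flow_continuous (f_flow _)).
have A_t k : A k (t k.+1) = A k.+1 (t k.+1).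
  by rewrite /A subrr (flow0 (f_flow _)).
have zA k u : t k <= u < t k.+1 -> z u = A k u by move=> ku; rewrite /z (c_eq k).
have zA0 u : u < t 1%N -> z u = A 0%N u.
  move=> u1; have [u0|u0] := ltP u 0; first by rewrite /z c_neg.
  by apply: zA; rewrite t0 u0.
have near_zA k u : t k < u < t k.+1 -> \forall v \near u, z v = A k v.
  move=> /andP[ku uk]; near=> v; apply: zA; apply/andP; split.
    by near: v; exact: lt_le_nbhsr.
  by near: v; exact: lt_nbhsl.
have zc : continuous z.
  move=> u; have [u1|u1] := ltP u (t 1%N).
    have h : \forall v \near u, A 0%N v = z v.
      near=> v; rewrite zA0//; near: v; exact: lt_nbhsl.
    by apply: cvg_near_eq h _; rewrite zA0//; exact: Ac.
  have ck : t (c u) <= u < t (c u).+1.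
    by rewrite c_lt c_le//; apply: le_trans u1; exact: grid_ge0.
  have [cu|] := ltP (t (c u)) u.
    have h : \forall v \near u, A (c u) v = z v.
      by apply: filterS (near_zA (c u) u _) => //; rewrite cu c_lt.
    by apply: cvg_near_eq h _; exact: Ac.
  move: ck; case cu : (c u) => [|k] /andP[cu1 cu2] uc.
    by move: u1; rewrite t0 in uc; rewrite leNgt (le_lt_trans uc)// -t0 t_S.
  have {cu1 cu2}ut : u = t k.+1 by apply/eqP; rewrite eq_le uc cu1.
  have zu : z u = A k.+1 u by rewrite /z cu.
  apply/left_right_continuousP; split.
    rewrite zu {2}ut -A_t -ut.
    have h : \forall v \near u^'-, A k v = z v.
      near=> v; rewrite (zA k)//; apply/andP; split.
        by apply/ltW; near: v; apply: nbhs_left_gt; rewrite ut.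
      by rewrite -ut; near: v; exact: nbhs_left_lt.
    by apply: cvg_near_eq h _; apply: cvg_at_left_filter; exact: Ac.
  rewrite zu.
  have h : \forall v \near u^'+, A k.+1 v = z v.
    near=> v; rewrite (zA k.+1)//; apply/andP; split.
      by rewrite -ut; apply/ltW; near: v; exact: nbhs_right_gt.
    by near: v; apply: nbhs_right_lt; rewrite ut.
  by apply: cvg_near_eq h _; apply: cvg_at_right_filter; exact: Ac.
exists z; split.
- by rewrite /z (c_eq 0%N) ?t0 ?lexx ?subr0// /A ?t0 ?subr0 ?(flow0 (f_flow _))//= -t0.
- exact: continuous_subspaceT.
- move=> u u0 ns; have ck : t (c u) <= u < t (c u).+1 by rewrite c_lt c_le// ltW.
  have cu : t (c u) < u.
    move: ck => /andP[+ _]; rewrite le_eqVlt => /predU1P[ut|//].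
    case: (c u) ut => [|k] ut; first by move: u0; rewrite -ut t0 ltxx.
    by exfalso; apply: ns; have [_ _ ->] := s_t; exists k.
  apply: (@near_eq_is_derive _ _ _ (A (c u))).
    by apply: filterS (near_zA (c u) u _) => //; rewrite cu c_lt.
  rewrite (signal_const ck).
  exact: (is_derive_translate (y := Phi _ ^~ _) (flow_derive (f_flow _) _ _)).
Unshelve. all: by end_near.
Qed.

(** Existence makes the value picked by [switched_flow] an actual solution, and
    every solution has the stated values. *)
Lemma switched_flow_visit x k r : 0 <= r <= d k ->
  switched_flow f s (t k + r) x = Phi (m k) r (visit Phi m d x k).
Proof.
rewrite /switched_flow; case: xgetP => [z _ zP|]; first exact: switched_solution_visit.
by have [z zP] := switched_solution_exists x; move=> /(_ z).
Qed.

End OneSignal.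
End SignalFlow.

Section SignalSchedule.
Variables (R : realType) (M : nat).

(** Otherwise the signal would be constant around [t k.+1], which would not be a
    switching instant. *)
Lemma signal_switch (s : R -> 'I_M) (t : nat -> R) k :
  signals s -> enumerates_instants s t -> s (t k) != s (t k.+1).
Proof.
move=> s_signal s_t; have [t0 t_inc inst] := s_t.
have : switching_instants s (t k.+1) by rewrite inst; exists k.
move=> [_]; apply: contra_not_neq => sk.
have t1 : t k < t k.+1 by exact: t_inc.
have t2 : t k.+1 < t k.+2 by exact: t_inc.
near=> v; have [kv|vk] := leP (t k.+1) v.
  by apply: (signal_const s_signal s_t); rewrite kv/=; near: v; exact: lt_nbhsl.
rewrite -sk; apply: (signal_const s_signal s_t); rewrite vk andbT.
by near: v; exact: lt_le_nbhsr.
Unshelve. all: by end_near.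
Qed.

Lemma elapsed_unbounded (d : nat -> R) e : 0 < e -> (forall k, e <= d k) ->
  forall T, exists k, T < elapsed d k.
Proof.
move=> e0 ed T.
have le k : e * k%:R <= elapsed d k.
  elim: k => [|k IH]; first by rewrite mulr0 /elapsed big_ord0.
  by rewrite elapsedS -natr1 mulrDr mulr1 lerD.
have := archi_boundP (normr_ge0 (T / e)); set k := Num.bound _ => Tk.
exists k; apply: lt_le_trans (le k); rewrite mulrC -ltr_pdivrMr//.
exact: le_lt_trans (ler_norm _) Tk.
Qed.

(** The lower bound on the dwells makes the instants unbounded, so that they cut
    the half line into cells on which the signal can be prescribed. *)
Lemma schedule_signal (m : nat -> 'I_M) (d : nat -> R) e : 0 < e ->
  (forall k, e <= d k) -> (forall k, m k != m k.+1) ->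
  exists s, [/\ signals s, enumerates_instants s (elapsed d)
    & forall k, s (elapsed d k) = m k].
Proof.
move=> e0 ed mm; set t := elapsed d.
have t0 : t 0%N = 0 by rewrite /t /elapsed big_ord0.
have t_S k : t k < t k.+1 by rewrite /t elapsedS ltrDl (lt_le_trans e0).
have t_inc : {homo t : k l / (k < l)%N >-> k < l} by exact: homo_ltn lt_trans t_S.
have t_unb : forall T, exists k, T < t k by exact: elapsed_unbounded e0 ed.
have [c [c_lt _ c_le c_eq]] := grid_cell t0 t_inc t_unb.
pose s u := m (c u).
have st k : s (t k) = m k by rewrite /s (c_eq k)// lexx t_S.
have near_s k u : t k < u < t k.+1 -> \forall v \near u, s v = m k.
  move=> /andP[ku uk]; near=> v; rewrite /s (c_eq k)//; apply/andP; split.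
    by near: v; exact: lt_le_nbhsr.
  by near: v; exact: lt_nbhsl.
have inst : switching_instants s = range (fun k => t k.+1).
  apply/seteqP; split => [u [u0 ns]|_ [k _ <-]].
    have := c_le _ (ltW u0); rewrite le_eqVlt => /predU1P[ut|ut].
      case: (c u) ut => [|k] ut; first by move: u0; rewrite -ut t0 ltxx.
      by exists k.
    exfalso; apply: ns; rewrite {2}/s; apply: near_s.
    by rewrite ut c_lt.
  split; first by rewrite -t0 t_inc.
  move=> h; have := mm k; rewrite -(st k.+1).
  have h1 : \forall v \near (t k.+1)^'-, s v = s (t k.+1).
    by apply: cvg_within; exact: h.
  have h2 : \forall v \near (t k.+1)^'-, s v = m k.
    near=> v; rewrite /s (c_eq k)//; apply/andP; split.
      by apply/ltW; near: v; exact: nbhs_left_gt.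
    by near: v; exact: nbhs_left_lt.
  near (t k.+1)^'- => v.
  have <- : s v = s (t k.+1) by near: v.
  have -> : s v = m k by near: v.
  by rewrite eqxx.
exists s; split => //; split.
  move=> T; have [K TK] := t_unb T.
  apply: (@sub_finite_set _ _ ((fun k => t k.+1) @` `I_K)); last first.
    exact/finite_image/finite_II.
  rewrite inst => _ [[k _ <-] /= kT]; exists k => //=.
  rewrite ltnNge; apply/negP => Kk.
  have := grid_le t_inc (leqW Kk); apply/negP.
  by rewrite -ltNge (le_lt_trans kT).
move=> u u0; near=> v; rewrite /s (c_eq (c u))//; apply/andP; split.
  by apply: le_trans (c_le _ u0) _; near: v; exact: nbhs_right_ge.
by near: v; apply: nbhs_right_lt; exact: c_lt.
Unshelve. all: by end_near.
Qed.

End SignalSchedule.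

(** * From Lyapunov functions to stability *)

Section LyapunovToGUAS.
Variables (R : realType) (n M : nat).
Variable f : 'I_M -> 'rV[R]_n -> 'rV[R]_n.
Variable Phi : 'I_M -> R -> 'rV[R]_n -> 'rV[R]_n.
Hypotheses (f_lip : forall i, locally_lipschitz (f i))
           (f0 : forall i, f i 0 = 0)
           (f_flow : forall i, is_flow (f i) (Phi i)).

Section Lyapunov.
Variables (tau1 tau2 : R).
Hypotheses (tau1_ge0 : 0 <= tau1) (tau12 : tau1 <= tau2).
Variables (a1 a2 : R -> R) (Vm Vp : 'I_M -> 'rV[R]_n -> R).
Hypotheses (a1K : class_Kinfty a1) (a2K : class_Kinfty a2).
Hypothesis Vm_bounds : forall i x, a1 (enorm x) <= Vm i x <= a2 (enorm x).
Hypothesis V_flow : forall i t x, 0 <= t <= tau2 - tau1 ->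
  Vp i (Phi i t x) <= expR (- t) * Vm i x.
Hypothesis V_jump : forall i j x, i != j ->
  Vm j (Phi i tau1 x) <= expR (- tau1) * Vp i x.

Lemma lyapunov_dwell_decay i j t x : i != j -> tau1 <= t <= tau2 ->
  Vm j (Phi i t x) <= expR (- t) * Vm i x.
Proof.
move=> ij /andP[t1 t2]; have {1}-> : t = tau1 + (t - tau1) by rewrite addrC subrK.
rewrite (flowD (f_flow i)); apply: le_trans (V_jump _ ij) _.
have -> : - t = - tau1 + - (t - tau1) by ring.
rewrite expRD -mulrA ler_wpM2l ?expR_ge0// V_flow//.
by rewrite subr_ge0 t1 lerB.
Qed.

(** During the last, uncompleted dwell nothing is known from the Lyapunov
    functions beyond time [tau2 - tau1]; there, as on the possibly short first
    dwell, the flows are controlled by [flow_minorant] alone. *)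
Lemma lyapunov_GUAS_star : GUAS f (S_dw_star tau1 tau2).
Proof.
have tau2_ge0 := le_trans tau1_ge0 tau12.
have [w wK w_flow] := flow_minorant f_lip f0 f_flow tau2_ge0.
have [iw iwK iwP] := class_Kinfty_inv wK.
(* One [tau2] pays for the first dwell and one for the last. *)
have [b bKL bP] := KL_of_exp_bound (2 * tau2) (class_Kinfty_comp a1K wK)
  (class_Kinfty_comp a2K iwK).
exists b => // s x u [s_signal [t s_t [t1 dwell]]] u0.
have [t0 t_inc _] := s_t.
have [c [c_lt _ c_le _]] := grid_cell t0 t_inc (instants_unbounded s_signal s_t).
pose m k := s (t k); pose d k := t k.+1 - t k; pose k := c u.
have d_bnd j : 0 <= d j <= tau2.
  rewrite subr_ge0 ltW ?t_inc//=; case: j => [|j]; first by rewrite /d t0 subr0.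
  by have /andP[] := dwell j.
have r_bnd : 0 <= u - t k <= d k by rewrite subr_ge0 c_le//= lerB// ltW.
have -> : switched_flow f s u x = Phi (m k) (u - t k) (visit Phi m d x k).
  by rewrite -(switched_flow_visit f_lip f_flow s_signal s_t _ r_bnd) addrC subrK.
have a2iw_ge0 : 0 <= a2 (iw (enorm x)).
  exact: class_K_ge0 a2K.1 (class_K_ge0 iwK.1 (enorm_ge0 x)).
have iw_flow y i r : 0 <= r <= tau2 -> enorm (Phi i r y) <= iw (enorm y).
  by move=> rT; rewrite iwP ?enorm_ge0// w_flow.
have Vm_visit j : Vm (m j.+1) (visit Phi m d x j.+1) <=
    expR (t 1%N - t j.+1) * a2 (iw (enorm x)).
  elim: j => [|j IH].
    rewrite subrr expR0 mul1r; have /andP[_ h] := Vm_bounds (m 1%N) (visit Phi m d x 1).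
    apply: le_trans h _; apply: class_K_le a2K.1 (enorm_ge0 _) _.
    by rewrite /= iw_flow.
  apply: le_trans (lyapunov_dwell_decay _ _ (dwell j)) _.
    exact: signal_switch s_signal s_t.
  apply: le_trans (ler_wpM2l (expR_ge0 _) IH) _.
  rewrite mulrA -expRD le_eqVlt; apply/orP; left; apply/eqP.
  by congr (expR _ * _); rewrite /d; ring.
have a1_visit : a1 (enorm (visit Phi m d x k)) <=
    expR (tau2 - t k) * a2 (iw (enorm x)).
  case: (k) => [|j].
    have /andP[h1 h2] := Vm_bounds (m 0%N) x; apply: le_trans (le_trans h1 h2) _.
    rewrite t0 subr0; apply: (@le_trans _ _ (a2 (iw (enorm x)))).
      apply: class_K_le a2K.1 (enorm_ge0 _) _.
      by rewrite -{1}(flow0 (f_flow (m 0%N)) x) iw_flow// lexx.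
    by rewrite ler_peMl// -expR0 ler_expR.
  have /andP[h _] := Vm_bounds (m j.+1) (visit Phi m d x j.+1).
  apply: le_trans h (le_trans (Vm_visit j) _).
  by rewrite ler_wpM2r// ler_expR lerB.
apply: bP => //=; rewrite ?enorm_ge0//.
apply: (@le_trans _ _ (a1 (enorm (visit Phi m d x k)))).
  apply: class_K_le a1K.1 (class_K_ge0 wK.1 (enorm_ge0 _)) _.
  apply: w_flow; case/andP: r_bnd => -> /le_trans; apply.
  by case/andP: (d_bnd k).
apply: le_trans a1_visit _; rewrite ler_wpM2r// ler_expR.
case/andP: r_bnd => _ h; have /andP[_ h2] := d_bnd k; lra.
Qed.

End Lyapunov.

Lemma S_dw_sub_star (tau1 tau2 : R) :
  @S_dw R M tau1 tau2 `<=` @S_dw_star R M tau1 tau2.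
Proof.
move=> s [s_signal [t s_t dwell]]; split => //; exists t => //; split => //.
by have [t0 _ _] := s_t; have := dwell 0%N; rewrite t0 subr0 => /andP[].
Qed.

Lemma GUAS_sub (S S' : set (R -> 'I_M)) : S `<=` S' -> GUAS f S' -> GUAS f S.
Proof. by move=> SS' [b bKL bP]; exists b => // s x t /SS'; exact: bP. Qed.

End LyapunovToGUAS.

(** * From stability to Lyapunov functions *)

Section Converse.
Variables (R : realType) (n M : nat).
Variable f : 'I_M -> 'rV[R]_n -> 'rV[R]_n.
Variable Phi : 'I_M -> R -> 'rV[R]_n -> 'rV[R]_n.
Hypotheses (f_lip : forall i, locally_lipschitz (f i))
           (f_flow : forall i, is_flow (f i) (Phi i)).
Variables (tau1 tau2 : R).
Hypotheses (tau1_ge0 : 0 <= tau1) (tau12 : tau1 <= tau2).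

Definition dwell_schedule (m : nat -> 'I_M) (d : nat -> R) : Prop :=
  forall k, m k != m k.+1 /\ tau1 <= d k <= tau2.

(** Each further visit applies a flow to a perturbed time and a perturbed state,
    which [flow_joint_continuous] controls. *)
Lemma visit_perturb m d x k e : dwell_schedule m d -> 0 < tau2 -> 0 < e ->
  exists2 r, 0 < r & forall q, 0 < q < r ->
    enorm (visit Phi m (fun j => Num.max (d j) q) x k - visit Phi m d x k) < e.
Proof.
move=> md t20; elim: k e => [|k IH] e e0 /=.
  by exists 1 => // q _; rewrite subrr enorm0.
have [_ /andP[dk1 dk2]] := md k; have dk0 := le_trans tau1_ge0 dk1.
have [|r r0 rP] := flow_joint_continuous (f_lip (m k)) (f_flow (m k))
  (T := tau2) (t := d k) (visit Phi m d x k) _ e0; first by rewrite dk0.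
have [r' r'0 r'P] := IH r r0.
exists (Num.min tau2 (Num.min r r')); first by rewrite !lt_min t20 r0.
move=> q /andP[q0]; rewrite !lt_min => /and3P[qt qr qr'].
apply: rP; last by apply: r'P; rewrite q0.
  by rewrite le_max dk0/= ge_max dk2 ltW.
case: (leP (d k) q) => h; last by rewrite subrr normr0.
by rewrite ger0_norm ?subr_ge0//; lra.
Qed.

(** A schedule with dwells bounded away from 0 is that of a signal. Zero dwells, which
    occur when [tau1 = 0], are reached by lengthening every dwell to at least
    [q] and letting [q] tend to 0; time only increases, so the bound at the
    longer time is the stronger one. *)
Lemma schedule_bound (b : R -> R -> R) : class_KL b -> 0 < tau2 ->
  (forall s x t, S_dw tau1 tau2 s -> 0 <= t ->
      enorm (switched_flow f s t x) <= b (enorm x) t) ->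
  forall m d x k r, dwell_schedule m d -> 0 <= r <= d k ->
    enorm (Phi (m k) r (visit Phi m d x k)) <= b (enorm x) (elapsed d k + r).
Proof.
move=> bKL t20 bP m d x k r md /andP[r0 rd].
have elapsed_ge0 (d' : nat -> R) : (forall j, 0 <= d' j) -> 0 <= elapsed d' k.
  by move=> h; rewrite /elapsed sumr_ge0.
have d_ge0 j : 0 <= d j by have [_ /andP[h _]] := md j; exact: le_trans h.
have perturbed q : 0 < q -> q <= tau2 ->
    enorm (Phi (m k) r (visit Phi m (fun j => Num.max (d j) q) x k)) <=
      b (enorm x) (elapsed d k + r).
  move=> q0 qt; pose dq j := Num.max (d j) q.
  have [||s [s_signal s_t sm]] := @schedule_signal R M m dq q q0.
  - by move=> j; rewrite le_max lexx orbT.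
  - by move=> j; have [] := md j.
  have stepq j : elapsed dq j.+1 - elapsed dq j = dq j.
    by rewrite elapsedS addrC addKr.
  have rdq : 0 <= r <= elapsed dq k.+1 - elapsed dq k.
    by rewrite stepq r0 le_max rd.
  have := switched_flow_visit f_lip f_flow s_signal s_t x rdq.
  rewrite sm (@eq_visit _ _ _ _ _ m _ dq) => [|j _|j _]; rewrite ?sm ?stepq// => <-.
  have s_dw : S_dw tau1 tau2 s.
    split => //; exists (elapsed dq) => // j; rewrite stepq.
    by have [_ /andP[h1 h2]] := md j; rewrite le_max h1/= ge_max h2 qt.
  have dq0 : 0 <= elapsed dq k by apply: elapsed_ge0 => j; rewrite le_max d_ge0.
  apply: le_trans (bP s x _ s_dw _) _; first by rewrite addr_ge0.
  have [_ _ decr _] := bKL; apply: decr; rewrite ?enorm_ge0// ?in_itv/= ?andbT.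
  - by rewrite addr_ge0// elapsed_ge0.
  - by rewrite addr_ge0.
  - by rewrite lerD2r; apply: ler_sum => j _; rewrite le_max lexx.
rewrite leNgt; apply/negP; rewrite -subr_gt0 => e0.
have [|r1 r10 r1P] := flow_joint_continuous (f_lip (m k)) (f_flow (m k))
  (T := r) (t := r) (visit Phi m d x k) _ e0; first by rewrite r0 lexx.
have [r2 r20 r2P] := visit_perturb x k md t20 r10.
pose q := Num.min tau2 (r2 / 2).
have q0 : 0 < q by rewrite lt_min t20 divr_gt0.
have qr2 : q < r2.
  by apply: (@le_lt_trans _ _ (r2 / 2)); [rewrite ge_min lexx orbT|lra].
have := perturbed q q0; rewrite ge_min lexx => /(_ isT) h.
have h1 : enorm (visit Phi m (fun j => Num.max (d j) q) x k -
    visit Phi m d x k) < r1.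
  by apply: r2P; rewrite q0.
have := r1P r _ _ _ h1; rewrite r0 lexx subrr normr0 => /(_ isT r10).
rewrite enorm_distC.
have := enorm_lip (Phi (m k) r (visit Phi m d x k))
  (Phi (m k) r (visit Phi m (fun j => Num.max (d j) q) x k)).
lra.
Qed.

(** Gronwall's inequality piece by piece: the Lipschitz constant being the same
    for all modes, the factors multiply to one exponential of the total
    time. *)
Lemma visit_dist m d x y B L k r : dwell_schedule m d -> 0 <= r <= d k ->
  (forall i z z', enorm z <= B -> enorm z' <= B ->
    enorm (f i z - f i z') <= L * enorm (z - z')) ->
  (forall z j s, z = x \/ z = y -> 0 <= s <= d j ->
    enorm (Phi (m j) s (visit Phi m d z j)) <= B) ->
  enorm (Phi (m k) r (visit Phi m d x k) - Phi (m k) r (visit Phi m d y k)) <=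
    expR (L * (elapsed d k + r)) * enorm (x - y).
Proof.
move=> md rd lip bnd.
have piece j s : 0 <= s <= d j ->
    enorm (Phi (m j) s (visit Phi m d x j) - Phi (m j) s (visit Phi m d y j)) <=
      expR (L * s) * enorm (visit Phi m d x j - visit Phi m d y j).
  move=> /andP[s0 sd]; apply: (flow_dist (f_flow (m j)) (rho := B)) => //.
    exact: lip.
  move=> u /andP[u0 us]; have ud : 0 <= u <= d j by rewrite u0 (le_trans (ltW us)).
  by split; apply: bnd => //; [left|right].
have visited : enorm (visit Phi m d x k - visit Phi m d y k) <=
    expR (L * elapsed d k) * enorm (x - y).
  elim: k {rd} => [|k IH /=]; first by rewrite /elapsed big_ord0 mulr0 expR0 mul1r.
  have dk : 0 <= d k <= d k.
    by have [_ /andP[h _]] := md k; rewrite lexx (le_trans tau1_ge0).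
  apply: le_trans (piece k (d k) dk) _.
  by rewrite elapsedS mulrDr expRD [expR _ * expR (L * d k)]mulrC -[leRHS]mulrA
    ler_pM2l ?expR_gt0.
apply: le_trans (piece k r rd) _.
by rewrite mulrDr expRD [expR _ * expR (L * r)]mulrC -[leRHS]mulrA ler_pM2l ?expR_gt0.
Qed.

Section SupFunction.
Variables (b : R -> R -> R) (w h : R -> R).
Hypotheses (bKL : class_KL b) (wK : class_Kinfty w) (hK : class_Kinfty h).
Hypothesis w_lip : forall s t, 0 <= s -> s <= t -> w t <= w s + 2 * (t - s).
Hypothesis wb : forall r t, 0 <= r -> 0 <= t ->
  w (b r t) <= expR (- (2 * t)) * h r.
Hypothesis b_bound : forall m d x k r, dwell_schedule m d -> 0 <= r <= d k ->
    enorm (Phi (m k) r (visit Phi m d x k)) <= b (enorm x) (elapsed d k + r).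

(** [C] selects the schedules that enter the supremum: [V_i^-] and [V_i^+] are
    obtained from two choices of [C]. *)
Variable C : (nat -> 'I_M) -> (nat -> R) -> Prop.

Definition traj_value (x : 'rV[R]_n) m d k r : R :=
  expR (elapsed d k + r) * w (enorm (Phi (m k) r (visit Phi m d x k))).

Definition admissible m d k r := [/\ C m d, dwell_schedule m d & 0 <= r <= d k].

Definition sup_value (x : 'rV[R]_n) : R :=
  sup [set v | exists m d k r, admissible m d k r /\ v = traj_value x m d k r].

Hypothesis C_ex : exists m d, C m d /\ dwell_schedule m d.

Lemma elapsed_ge0 m d k r : admissible m d k r -> 0 <= elapsed d k + r.
Proof.
move=> [_ md /andP[r0 _]]; rewrite addr_ge0// sumr_ge0// => j _.
by have [_ /andP[+ _]] := md j; exact: le_trans.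
Qed.

Lemma traj_value_ge0 x m d k r : 0 <= traj_value x m d k r.
Proof. by rewrite mulr_ge0 ?expR_ge0// (class_K_ge0 wK.1) ?enorm_ge0. Qed.

Lemma traj_value_le x m d k r : admissible m d k r ->
  traj_value x m d k r <= expR (- (elapsed d k + r)) * h (enorm x).
Proof.
move=> adm; have T0 := elapsed_ge0 adm; have [_ md rd] := adm.
set T := elapsed d k + r in T0 *.
have -> : expR (- T) = expR T * expR (- (2 * T)) :> R.
  by rewrite -expRD; congr expR; ring.
rewrite -mulrA ler_pM2l ?expR_gt0//; apply: le_trans (wb (enorm_ge0 x) T0).
by apply: (class_K_le wK.1) (enorm_ge0 _) _; exact: b_bound.
Qed.

Let h_ge0 (x : 'rV[R]_n) : 0 <= h (enorm x).
Proof. exact: (class_K_ge0 hK.1 (enorm_ge0 x)). Qed.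

Lemma traj_value_le_h x m d k r : admissible m d k r ->
  traj_value x m d k r <= h (enorm x).
Proof.
move=> adm; apply: le_trans (traj_value_le x adm) _.
by rewrite ler_piMl// -expR0 ler_expR oppr_le0 (elapsed_ge0 adm).
Qed.

Lemma sup_value_ge x m d k r : admissible m d k r ->
  traj_value x m d k r <= sup_value x.
Proof.
move=> adm; apply: sup_upper_bound; last by exists m, d, k, r.
split; first by exists (traj_value x m d k r), m, d, k, r.
by exists (h (enorm x)) => _ [m' [d' [k' [r' [adm' ->]]]]]; exact: traj_value_le_h.
Qed.

Let adm0 : exists m d, admissible m d 0%N 0.
Proof.
have [m [d [Cmd md]]] := C_ex; exists m, d; split => //.
by rewrite lexx; have [_ /andP[+ _]] := md 0%N; exact: le_trans.
Qed.

Lemma sup_value_le x c :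
  (forall m d k r, admissible m d k r -> traj_value x m d k r <= c) ->
  sup_value x <= c.
Proof.
move=> vc; apply: ge_sup; last by move=> _ [m [d [k [r [adm ->]]]]]; exact: vc.
by have [m [d adm]] := adm0; exists (traj_value x m d 0%N 0), m, d, 0%N, 0.
Qed.

Lemma sup_value_bounds x : w (enorm x) <= sup_value x <= h (enorm x).
Proof.
apply/andP; split; last by apply: sup_value_le => m d k r; exact: traj_value_le_h.
have [m [d adm]] := adm0; have := sup_value_ge x adm.
by rewrite /traj_value /elapsed big_ord0 addr0 expR0 mul1r /= (flow0 (f_flow _)).
Qed.

(** The tails of the trajectories contribute at most [exp (- t) * h], which is
    small uniformly on bounded sets, and up to a fixed time the trajectories
    depend on the initial state in an equi-Lipschitz way. *)
Lemma sup_value_continuous : continuous sup_value.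
Proof.
move=> x; apply: (@cvg_two_sided R _ (nbhs x)) => e e0.
have e2 : 0 < e / 2 by rewrite divr_gt0.
pose rho := enorm x + 1.
have rho0 : 0 <= rho by rewrite addr_ge0 ?enorm_ge0.
have h0 : 0 <= h rho := class_K_ge0 hK.1 rho0.
have h_rho y : enorm y <= rho -> h (enorm y) <= h rho.
  by move=> yr; exact: class_K_le hK.1 (enorm_ge0 y) yr.
(* Beyond time [T] every value, at any state of norm at most [rho], is at most
   [e / 2]. *)
have [T T0 TP] : exists2 T, 0 <= T & forall t, T <= t ->
    expR (- t) * h rho <= e / 2.
  pose q := e / 2 / (h rho + 1).
  have q0 : 0 < q by rewrite divr_gt0//; lra.
  exists (Num.max 0 (- ln q)); first by rewrite le_max lexx.
  move=> t; rewrite ge_max => /andP[_]; rewrite lerNl => tq.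
  apply: (@le_trans _ _ (q * (h rho + 1))).
    apply: ler_pM; rewrite ?expR_ge0//; last by rewrite lerDl.
    by rewrite -[leRHS]lnK ?posrE// ler_expR.
  by rewrite /q divfK// gt_eqF//; lra.
pose B := b rho 0.
have [_ bK b_decr _] := bKL.
have bnd m d y k r : admissible m d k r -> enorm y <= rho ->
    enorm (Phi (m k) r (visit Phi m d y k)) <= B.
  move=> adm yr; have := elapsed_ge0 adm; have [_ md rd] := adm => T0'.
  apply: le_trans (b_bound y md rd) _; apply: (@le_trans _ _ (b (enorm y) 0)).
    by apply: b_decr; rewrite ?enorm_ge0// in_itv/= andbT.
  exact: class_K_le (bK 0 (lexx 0)) (enorm_ge0 y) yr.
have [L [L0 LP]] : exists L, 0 <= L /\
    forall i z z', enorm z <= B -> enorm z' <= B ->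
    enorm (f i z - f i z') <= L * enorm (z - z').
  have [L LP] : exists L, forall i, forall z z',
      enorm z <= B -> enorm z' <= B ->
      enorm (f i z - f i z') <= L * enorm (z - z').
    apply: finite_uniform => [i L L' LL' H z z' zB z'B|i].
      by apply: le_trans (H z z' zB z'B) _; rewrite ler_wpM2r ?enorm_ge0.
    by have [L _ LP] := locally_lipschitz_ball (f_lip i) B; exists L.
  exists (Num.max L 0); split; first by rewrite le_max lexx orbT.
  move=> i z z' zB z'B; apply: le_trans (LP i z z' zB z'B) _.
  by rewrite ler_wpM2r ?enorm_ge0// le_max lexx.
have w_dist s t : 0 <= s -> 0 <= t -> w s <= w t + 2 * `|s - t|.
  move=> s0 t0; have [st|/ltW ts] := leP s t.
    apply: le_trans (class_K_le wK.1 s0 st) _.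
    by rewrite lerDl mulr_ge0.
  by rewrite ger0_norm ?subr_ge0// w_lip.
(* Up to time [T] every value is [K]-Lipschitz in the state: weight, Lipschitz
   constant of [w], Gronwall factor. *)
pose K := expR T * (2 * expR (L * T)).
have K0 : 0 < K by rewrite !mulr_gt0 ?expR_gt0.
have value_near y z m d k r : admissible m d k r ->
    enorm y <= rho -> enorm z <= rho -> K * enorm (y - z) <= e / 2 ->
    traj_value y m d k r <= traj_value z m d k r + e / 2.
  move=> adm yr zr yz; have T0' := elapsed_ge0 adm; have [_ md rd] := adm.
  have [TT|/ltW TT] := leP T (elapsed d k + r).
    apply: le_trans (traj_value_le y adm) _; apply: (@le_trans _ _ (e / 2)).
      apply: le_trans (TP _ TT); rewrite ler_wpM2l ?expR_ge0//; exact: h_rho.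
    by rewrite lerDr traj_value_ge0.
  have dist : enorm (Phi (m k) r (visit Phi m d y k) -
      Phi (m k) r (visit Phi m d z k))
      <= expR (L * T) * enorm (y - z).
    apply: le_trans (visit_dist md rd LP _) _.
      move=> z' j s zz' sd; have [Cmd _ _] := adm.
      by apply: bnd; [split|case: zz' => ->].
    by rewrite ler_wpM2r ?enorm_ge0// ler_expR ler_wpM2l.
  rewrite /traj_value; set a := enorm (Phi _ _ (visit _ _ _ y _)).
  set c := enorm (Phi _ _ (visit _ _ _ z _)).
  have ac : w a <= w c + 2 * (expR (L * T) * enorm (y - z)).
    apply: le_trans (w_dist a c (enorm_ge0 _) (enorm_ge0 _)) _.
    rewrite lerD2l ler_pM2l//; apply: le_trans _ dist.
    rewrite ler_norml; apply/andP; split.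
      rewrite lerNl opprB lerBlDl /c /a enorm_distC; exact: enorm_lip.
    by rewrite lerBlDl; exact: enorm_lip.
  apply: le_trans (ler_wpM2l (expR_ge0 _) ac) _; rewrite mulrDr lerD2l.
  apply: le_trans yz; rewrite /K !mulrA ler_wpM2r ?enorm_ge0//.
  by rewrite ler_wpM2r ?expR_ge0// ler_wpM2r// ler_expR.
have sup_near y z : enorm y <= rho -> enorm z <= rho ->
    K * enorm (y - z) <= e / 2 ->
    sup_value y <= sup_value z + e / 2.
  move=> yr zr yz; apply: sup_value_le => m d k r adm.
  apply: le_trans (value_near y z m d k r adm yr zr yz) _.
  by rewrite lerD2r sup_value_ge.
near=> y.
have yx : enorm (y - x) < 1 by near: y; apply: near_enorm.
have yx' : K * enorm (y - x) <= e / 2.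
  rewrite mulrC -ler_pdivlMr//; apply/ltW; near: y; apply: near_enorm.
  by rewrite divr_gt0.
have xr : enorm x <= rho by rewrite lerDl.
have yr : enorm y <= rho by have := enorm_lip y x; rewrite /rho; lra.
have := sup_near y x yr xr yx'.
have := sup_near x y xr yr; rewrite enorm_distC => /(_ yx').
by split; lra.
Unshelve. all: by end_near.
Qed.

End SupFunction.
End Converse.

Section Existence.
Variables (R : realType) (n M : nat).
Variable f : 'I_M -> 'rV[R]_n -> 'rV[R]_n.
Variable Phi : 'I_M -> R -> 'rV[R]_n -> 'rV[R]_n.
Variables (tau1 tau2 : R).
Hypotheses (f_lip : forall i, locally_lipschitz (f i))
           (f0 : forall i, f i 0 = 0)
           (f_flow : forall i, is_flow (f i) (Phi i))
           (tau1_ge0 : 0 <= tau1) (tau12 : tau1 <= tau2).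

Definition has_lyapunov : Prop :=
   exists (a1 a2 : R -> R) (Vm Vp : 'I_M -> 'rV[R]_n -> R),
     [/\ class_Kinfty a1 /\ class_Kinfty a2,
         forall i, continuous (Vm i) /\ continuous (Vp i),
         forall i x,
           a1 (enorm x) <= Vm i x <= a2 (enorm x) /\
           a1 (enorm x) <= Vp i x <= a2 (enorm x),
         forall i t x, 0 <= t <= tau2 - tau1 ->
           Vp i (Phi i t x) <= expR (- t) * Vm i x
       & forall i j x, i != j ->
           Vm j (Phi i tau1 x) <= expR (- tau1) * Vp i x].

(** With at most one mode there is no schedule to take a supremum over, but only
    the growth of the flow in bounded time has to be absorbed. *)
Lemma lyapunov_no_switching : (forall i j : 'I_M, i = j) -> has_lyapunov.
Proof.
move=> one; have tau2_ge0 := le_trans tau1_ge0 tau12.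
have [w wK w_flow] := flow_minorant f_lip f0 f_flow tau2_ge0.
have c1 : 1 <= expR (tau2 - tau1) by rewrite -expR0 ler_expR subr_ge0.
have cK := class_Kinfty_scale (expR_gt0 (tau2 - tau1)).
have cx x : enorm x <= expR (tau2 - tau1) * enorm (x : 'rV[R]_n).
  by rewrite ler_peMl ?enorm_ge0.
exists w, (fun r => expR (tau2 - tau1) * r),
  (fun _ x => expR (tau2 - tau1) * enorm x), (fun _ x => w (enorm x)); split => //.
- move=> i; split; first exact: class_K_enorm_continuous cK.1.
  exact: class_K_enorm_continuous wK.1.
- move=> i x; have wx : w (enorm x) <= enorm x.
    by rewrite -{1}(flow0 (f_flow i) x) w_flow// lexx.
  by rewrite !lexx (le_trans wx).
- move=> i t x /andP[t0 td]; rewrite mulrA -expRD.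
  apply: (@le_trans _ _ (enorm x)).
    by rewrite w_flow// t0 (le_trans td)// lerBlDr lerDl.
  by rewrite ler_peMl ?enorm_ge0// -expR0 ler_expR addrC subr_ge0.
- by move=> i j x; rewrite (one i j) eqxx.
Qed.

(** All dwells have length 0, so that both conditions compare values at the same
    state. *)
Lemma lyapunov_zero_dwell : tau2 = 0 -> has_lyapunov.
Proof.
move=> t20; have t10 : tau1 = 0 by apply/eqP; rewrite eq_le tau1_ge0 -t20 tau12.
have cK := class_Kinfty_scale (@ltr01 R).
exists (fun r => 1 * r), (fun r => 1 * r),
  (fun _ => @enorm R n), (fun _ => @enorm R n).
split => //.
- by move=> i; split; exact: enorm_continuous.
- by move=> i x; rewrite mul1r lexx.
- move=> i t x; rewrite t20 t10 subr0 => t0.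
  have -> : t = 0 by apply/eqP; rewrite eq_le andbC.
  by rewrite oppr0 expR0 mul1r (flow0 (f_flow i)).
- by move=> i j x _; rewrite t10 oppr0 expR0 mul1r (flow0 (f_flow i)).
Qed.

(** [V_i^-] takes the supremum over the schedules that start in mode [i],
    [V_i^+] over those among them whose first dwell is the shortest possible:
    prolonging the first dwell of the latter gives the former, and putting a
    dwell [tau1] in mode [i] before one of the former for a mode [j] other than
    [i] gives the latter. *)
Lemma lyapunov_switching (i0 j0 : 'I_M) : i0 != j0 -> 0 < tau2 ->
  GUAS f (S_dw tau1 tau2) -> has_lyapunov.
Proof.
move=> ij0 t20 [b bKL bP].
have [w [h [wK hK w_lip wb]]] := KL_exp_bound bKL.
have b_bound := schedule_bound f_lip f_flow tau1_ge0 bKL t20 bP.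
pose Cm i (m : nat -> 'I_M) (d : nat -> R) := m 0%N = i.
pose Cp i (m : nat -> 'I_M) (d : nat -> R) := m 0%N = i /\ d 0%N = tau1.
have Cp_ex i : exists m d, Cp i m d /\ dwell_schedule tau1 tau2 m d.
  pose j := if i == i0 then j0 else i0.
  have ij : i != j by rewrite /j; case: (eqVneq i i0) => [->|].
  exists (fun k => if odd k then j else i), (fun=> tau1); split => // k /=.
  by rewrite lexx tau12; case: (odd k) => //=; rewrite eq_sym.
have Cm_ex i : exists m d, Cm i m d /\ dwell_schedule tau1 tau2 m d.
  by have [m [d [[mi _] md]]] := Cp_ex i; exists m, d.
exists w, h, (fun i => sup_value Phi tau1 tau2 w (Cm i)),
  (fun i => sup_value Phi tau1 tau2 w (Cp i)); split => //.
- move=> i; split.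
    exact: (sup_value_continuous f_lip f_flow tau1_ge0 bKL wK hK w_lip wb
      b_bound (Cm_ex i)).
  exact: (sup_value_continuous f_lip f_flow tau1_ge0 bKL wK hK w_lip wb
    b_bound (Cp_ex i)).
- move=> i x; split.
    exact: (sup_value_bounds f_flow tau1_ge0 wK hK wb b_bound (Cm_ex i)).
  exact: (sup_value_bounds f_flow tau1_ge0 wK hK wb b_bound (Cp_ex i)).
- move=> i t x /andP[t0 td].
  apply: (sup_value_le tau1_ge0 (Cp_ex i)) => m d k r.
  move=> [[mi d0] md /andP[r0 rd]].
  (* The first dwell is prolonged by the time [t] already spent in mode [i]. *)
  pose d' j := if j is 0%N then tau1 + t else d j.
  have adm k' r' : 0 <= r' <= d' k' -> admissible tau1 tau2 (Cm i) m d' k' r'.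
    move=> rd'; split => // -[|j]; last exact: md.
    by split; [have [] := md 0%N|rewrite /= lerDl t0 addrC -lerBrDr].
  rewrite -[leLHS]mul1r -(expR0 R) -(addNr t) expRD -mulrA ler_pM2l ?expR_gt0//.
  case: k rd => [|k] rd.
    have rd' : 0 <= r + t <= d' 0%N by rewrite addr_ge0//= lerD2r -d0.
    have := sup_value_ge tau1_ge0 wK hK wb b_bound x (adm _ _ rd').
    apply: le_trans; rewrite /traj_value /elapsed !big_ord0 !add0r mulrA -expRD mi /=.
    by rewrite (flowD (f_flow i)) [t + r]addrC.
  have rd' : 0 <= r <= d' k.+1 by rewrite r0.
  have := sup_value_ge tau1_ge0 wK hK wb b_bound x (adm _ _ rd').
  apply: le_trans; rewrite /traj_value !elapsed_tail !visit_tail mulrA -expRD.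
  rewrite mi d0 -(flowD (f_flow i)) /=.
  have -> : t + (tau1 + elapsed (d \o S) k + r) = tau1 + t + elapsed (d \o S) k + r.
    by ring.
  by [].
- move=> i j x ij.
  apply: (sup_value_le tau1_ge0 (Cm_ex j)) => m d k r.
  move=> [mj md rd].
  (* A dwell [tau1] in mode [i] is put in front. *)
  pose m' l := if l is l'.+1 then m l' else i.
  pose d' l := if l is l'.+1 then d l' else tau1.
  have adm : admissible tau1 tau2 (Cp i) m' d' k.+1 r.
    split => // -[|l] /=; last exact: md.
    by rewrite mj lexx tau12.
  rewrite -[leLHS]mul1r -(expR0 R) -(addNr tau1) expRD -mulrA ler_pM2l ?expR_gt0//.
  have := sup_value_ge tau1_ge0 wK hK wb b_bound x adm.
  apply: le_trans; rewrite /traj_value elapsed_tail visit_tail mulrA -expRD addrA.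
  by [].
Qed.

Lemma GUAS_has_lyapunov : GUAS f (S_dw tau1 tau2) -> has_lyapunov.
Proof.
move=> guas; have [one|] := pselect (forall i j : 'I_M, i = j).
  exact: lyapunov_no_switching.
move=> /existsNP[i /existsNP[j /eqP ij]].
have [t20|t20] := eqVneq tau2 0; first exact: lyapunov_zero_dwell.
apply: (lyapunov_switching ij) => //.
by rewrite lt_def t20 (le_trans tau1_ge0).
Qed.

Lemma has_lyapunov_GUAS_star : has_lyapunov -> GUAS f (S_dw_star tau1 tau2).
Proof.
move=> [a1 [a2 [Vm [Vp [[a1K a2K] _ bnd V_flow V_jump]]]]].
apply: (lyapunov_GUAS_star f_lip f0 f_flow tau1_ge0 tau12 a1K a2K _ V_flow V_jump).
by move=> i x; have [] := bnd i x.
Qed.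

End Existence.

Theorem theorem1 (R : realType) (n M : nat)
    (f : 'I_M -> 'rV[R]_n -> 'rV[R]_n)
    (Phi : 'I_M -> R -> 'rV[R]_n -> 'rV[R]_n)
    (tau1 tau2 : R)
    (f_lip : forall i, locally_lipschitz (f i))
    (f0 : forall i, f i 0 = 0)
    (f_flow : forall i, is_flow (f i) (Phi i))
    (tau1_ge0 : 0 <= tau1) (tau12 : tau1 <= tau2) :
  (GUAS f (S_dw tau1 tau2) <->
   exists (a1 a2 : R -> R) (Vm Vp : 'I_M -> 'rV[R]_n -> R),
     [/\ class_Kinfty a1 /\ class_Kinfty a2,
         forall i, continuous (Vm i) /\ continuous (Vp i),
         forall i x,
           a1 (enorm x) <= Vm i x <= a2 (enorm x) /\
           a1 (enorm x) <= Vp i x <= a2 (enorm x),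
         forall i t x, 0 <= t <= tau2 - tau1 ->
           Vp i (Phi i t x) <= expR (- t) * Vm i x
       & forall i j x, i != j ->
           Vm j (Phi i tau1 x) <= expR (- tau1) * Vp i x]) /\
  (GUAS f (S_dw tau1 tau2) -> GUAS f (S_dw_star tau1 tau2)).
Proof.
have conv : GUAS f (S_dw tau1 tau2) -> has_lyapunov Phi tau1 tau2.
  exact: GUAS_has_lyapunov.
have direct : has_lyapunov Phi tau1 tau2 -> GUAS f (S_dw_star tau1 tau2).
  exact: has_lyapunov_GUAS_star.
split; last by move=> /conv/direct.
split; first exact: conv.
by move=> /direct; apply: GUAS_sub; exact: S_dw_sub_star.
Qed.
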